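(* Let $n$ be a positive integer, let $\mathbb{F}$ be a field and let $p$ be an odd rational prime. Let $V_{8n} = \langle a, b \mid a^{2n} = b^{4} = 1,\ ba = a^{-1}b^{-1},\ b^{-1}a = a^{-1}b \rangle$. (i) If $\mathrm{char}(\mathbb{F}) = 0$, or $\mathrm{char}(\mathbb{F}) = p$ with $\gcd(n,p)=1$, then the dimension of $\mathrm{Der}_{\mathbb{F}}(\mathbb{F}V_{8n})$ over $\mathbb{F}$ is $3(2n-1)$ if $n$ is odd and $6(n-1)$ if $n$ is even, and a basis is $$\mathcal{B} = \{d_{(\bar{a}, \bar{b})} \mid (\bar{a}, \bar{b}) \in B_{1} \cup B_{2} \cup B_{3} \cup B_{4}\},$$ where $$\begin{aligned} B_{1} = \{& ((a^{-2k} - a^{2k})b,\,0),\ ((a^{2k-1} - a^{-(2k+1)})b,\, a^{2k} - a^{-2k}),\ ((a^{-2k} - a^{2k})b^{3},\,0),\\ & ((a^{2k-1} - a^{-(2k+1)})b^{3},\,(a^{2k} - a^{-2k}) b^{2}),\ (0,\,(a^{2k} - a^{-2k}) b),\ (0,\,(a^{2k} - a^{-2k}) b^{3}) \mid 1 \leq k \leq \lfloor \tfrac{n-1}{2} \rfloor\},\\ B_{2} = \{& ((a^{2k-2}-a^{-2k}b^{2})b,\, a^{2k-1} - a^{-(2k-1)}b^{2}),\ (0,\,(a^{2k-1} - a^{-(2k-1)}b^{2})b) \mid 1 \leq k \leq \lfloor \tfrac{n+1}{2} \rfloor\},\\ B_{3} = \{& ((a^{-2k} - a^{2k-2}b^{2})b,\,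 a^{-(2k-1)} - a^{2k-1}b^{2}),\ (0,\,(a^{-(2k-1)} - a^{2k-1}b^{2})b) \mid 1 \leq k \leq \lceil \tfrac{n-1}{2} \rceil\},\\ B_{4} = \{& ((a^{-(2k-1)} - a^{2k-1}b^{2})b,\,0) \mid 1 \leq k \leq n\}. \end{aligned}$$ (ii) If $\mathrm{char}(\mathbb{F}) = p$ with $\gcd(n,p) \neq 1$, then the dimension of $\mathrm{Der}_{\mathbb{F}}(\mathbb{F}V_{8n})$ over $\mathbb{F}$ is $4(2n-1)$ if $n$ is odd and $8(n-1)$ if $n$ is even, and a basis is $$\mathcal{B}' = \{d_{(\bar{a}, \bar{b})} \mid (\bar{a}, \bar{b}) \in B_{1}' \cup B_{2}' \cup B_{3}' \cup B_{4}'\},$$ where $$\begin{aligned} B_{1}' = \{& ((a^{2k-1} - a^{-(2k+1)})b,\, a^{2k} - a^{-2k}),\ (a^{2k+1} - a^{-(2k-1)},\, (a^{2k} - a^{-2k}) b),\\ & ((a^{2k-1} - a^{-(2k+1)})b^{3},\, (a^{2k} - a^{-2k}) b^{2}),\ ((a^{2k+1} - a^{-(2k-1)})b^{2},\, (a^{2k} - a^{-2k}) b^{3}),\\ & ((a^{-2k} - a^{2k})b^{3},\,0),\ ((a^{-2k} - a^{2k})b,\,0),\ ((a^{-(2k-1)} - a^{2k+1})b^{2},\,0),\\ & (a^{-(2k-1)} - a^{2k+1},\,0) \mid 1 \leq k \leq \lfloor \tfrac{n-1}{2} \rfloor\},\\ B_{2}' = \{& ((a^{2k-2} - a^{-2k}b^{2})b,\,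 a^{2k-1} - a^{-(2k-1)}b^{2}),\ (a^{2k} - a^{-(2k-2)}b^{2},\, (a^{2k-1} - a^{-(2k-1)}b^{2})b) \mid 1 \leq k \leq \lfloor \tfrac{n+1}{2} \rfloor\},\\ B_{3}' = \{& ((a^{-2k} - a^{2k-2}b^{2})b,\, a^{-(2k-1)} - a^{2k-1}b^{2}),\ (a^{-(2k-2)} - a^{2k}b^{2},\, (a^{-(2k-1)} - a^{2k-1}b^{2})b) \mid 1 \leq k \leq \lceil \tfrac{n-1}{2} \rceil\},\\ B_{4}' = \{& ((a^{-(2k-1)} - a^{2k-1}b^{2})b,\,0),\ (a^{-(2k-2)} - a^{2k}b^{2},\,0) \mid 1 \leq k \leq n\}. \end{aligned}$$
   Context: $V_{8n}$ has order $8n$ and $V_{8n} = \{a^{i}b^{j} \mid 0 \leq i \leq 2n-1,\ 0 \leq j \leq 3\}$; $\mathbb{F}V_{8n}$ is its group algebra over $\mathbb{F}$. A derivation of a ring $R$ is an additive map $d: R \to R$ with $d(xy) = d(x)y + x\,d(y)$ for all $x,y \in R$. $\mathrm{Der}_{\mathbb{F}}(\mathbb{F}V_{8n})$ is the $\mathbb{F}$-vector space (pointwise operations) of all $\mathbb{F}$-derivations of $\mathbb{F}V_{8n}$, i.e. derivations $d$ with $d(\lambda)=0$ for all $\lambda \in \mathbb{F}$ (equivalently, $\mathbb{F}$-linear derivations). An $\mathbb{F}$-derivation of $\mathbb{F}V_{8n}$ is determined by its values on the generators $a$ and $b$; for $\bar a, \bar b \in \mathbb{F}V_{8n}$, $d_{(\bar{a},\bar{b})}$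 denotes the $\mathbb{F}$-derivation $d$ with $d(a) = \bar{a}$ and $d(b) = \bar{b}$. The assertion that a set of such $d_{(\bar a,\bar b)}$ is a basis includes the assertion that these derivations exist for all the listed pairs. A set indexed by an empty range of $k$ is empty. *)

(* Defs.v *)
From HB Require Import structures.
From mathcomp Require Import all_boot all_order all_algebra all_fingroup.
From mathcomp Require Import all_solvable all_field.

Set Implicit Arguments.
Unset Strict Implicit.
Unset Printing Implicit Defensive.

Import GRing.Theory.
Local Open Scope ring_scope.

(* The group algebra F[gT]: formal sums \sum_g u_g g are functions g |-> u_g,
   multiplied by convolution. The type is a fresh constant because
   {ffun gT -> F} already carries the pointwise product. *)
Definition group_algebra (F : fieldType) (gT : finGroupType) : Type :=
  {ffun gT -> F}.

Section GroupAlgebra.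

Variables (F : fieldType) (gT : finGroupType).
Local Notation FG := (group_algebra F gT).

HB.instance Definition _ := Vector.copy FG {ffun gT -> F^o}.

Definition group_elt (g : gT) : FG := [ffun h => (h == g)%:R].

Definition galg_mul (u v : FG) : FG :=
  [ffun g => \sum_h u h * v (h^-1 * g)%g].

Fact galg_mulA : associative galg_mul.
Proof.
move=> u v w; apply/ffunP=> g; rewrite !ffunE.
under eq_bigr => k _ do rewrite ffunE mulr_sumr.
under [RHS]eq_bigr => h _ do rewrite ffunE mulr_suml.
rewrite [RHS]exchange_big /=; apply: eq_bigr => k _.
rewrite (reindex_inj (mulgI k^-1%g)) /=; apply: eq_bigr => h _.
by rewrite mulrA invMg invgK -!mulgA mulKVg.
Qed.

Fact galg_mul1 : left_id (group_elt 1) galg_mul.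
Proof.
move=> u; apply/ffunP=> g; rewrite ffunE (bigD1 1%g) //= big1 => [|h /negPf nh].
  by rewrite ffunE eqxx mul1r addr0 invg1 mul1g.
by rewrite ffunE nh mul0r.
Qed.

Fact galg_1mul : right_id (group_elt 1) galg_mul.
Proof.
move=> u; apply/ffunP=> g; rewrite ffunE (bigD1 g) //= big1 => [|h nh].
  by rewrite ffunE mulVg eqxx mulr1 addr0.
by rewrite ffunE -(inj_eq (mulgI h)) mulKVg mulg1 eq_sym (negPf nh) mulr0.
Qed.

Fact galg_mulDl : left_distributive galg_mul +%R.
Proof.
move=> u v w; apply/ffunP=> g; rewrite !ffunE -big_split /=.
by apply: eq_bigr => h _; rewrite ffunE mulrDl.
Qed.

Fact galg_mulDr : right_distributive galg_mul +%R.
Proof.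
move=> u v w; apply/ffunP=> g; rewrite !ffunE -big_split /=.
by apply: eq_bigr => h _; rewrite ffunE mulrDr.
Qed.

Fact galg_one_neq0 : group_elt 1 != 0 :> FG.
Proof.
by apply/eqP=> /ffunP/(_ 1%g); rewrite !ffunE eqxx => /eqP; rewrite oner_eq0.
Qed.

HB.instance Definition _ := GRing.Zmodule_isNzRing.Build FG
  galg_mulA galg_mul1 galg_1mul galg_mulDl galg_mulDr galg_one_neq0.

Fact galg_scaleAl (c : F) (u v : FG) : c *: (u * v) = c *: u * v.
Proof.
apply/ffunP=> g; rewrite !ffunE /GRing.scale /= mulr_sumr.
by apply: eq_bigr => h _; rewrite ffunE mulrA.
Qed.

HB.instance Definition _ := GRing.Lmodule_isLalgebra.Build F FG galg_scaleAl.

Fact galg_scaleAr (c : F) (u v : FG) : c *: (u * v) = u * (c *: v).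
Proof.
apply/ffunP=> g; rewrite !ffunE /GRing.scale /= mulr_sumr.
by apply: eq_bigr => h _; rewrite ffunE mulrCA.
Qed.

HB.instance Definition _ := GRing.Lalgebra_isAlgebra.Build F FG galg_scaleAr.
HB.instance Definition _ := Algebra_isFalgebra.Build F FG.

Lemma group_eltM g h : group_elt (g * h)%g = group_elt g * group_elt h.
Proof.
apply/ffunP=> k; rewrite !ffunE (bigD1 g) //= big1 => [|l /negPf nl].
  by rewrite !ffunE eqxx mul1r addr0 (can2_eq (mulKVg g) (mulKg g)).
by rewrite ffunE nl mul0r.
Qed.

Lemma group_elt1 : group_elt 1 = 1. Proof. by []. Qed.

Lemma group_eltV g : group_elt g^-1 = (group_elt g)^-1.
Proof.
have Vg : group_elt g^-1 * group_elt g = 1 by rewrite -group_eltM mulVg.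
have gV : group_elt g * group_elt g^-1 = 1 by rewrite -group_eltM mulgV.
have Ug : group_elt g \is a GRing.unit by apply/unitrP; exists (group_elt g^-1).
by apply: (mulrI Ug); rewrite gV divrr.
Qed.

End GroupAlgebra.

Section Derivations.

Variables (F : fieldType) (A : falgType F).

Definition is_Fderivation (d : A -> A) : Prop :=
  [/\ {morph d : x y / x + y},
      forall x y, d (x * y) = d x * y + x * d y
    & forall c : F, d c%:A = 0].

(* The Leibniz defect x |-> (y |-> f (x * y) - f x * y - x * f y) of f. *)
Definition leibniz_fun (f : 'End(A)) (x : A) : 'End(A) :=
  (f \o amull x)%VF - amull (f x) - (amull x \o f)%VF.

Lemma leibniz_funE f x y : leibniz_fun f x y = f (x * y) - f x * y - x * f y.
Proof. by rewrite /leibniz_fun !(add_lfunE, opp_lfunE, comp_lfunE) !lfunE. Qed.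

Fact leibniz_fun_is_linear f : linear (leibniz_fun f).
Proof.
move=> c x y; apply/lfunP=> z.
rewrite leibniz_funE [RHS]add_lfunE scale_lfunE !leibniz_funE.
rewrite mulrDl -scalerAl !linearP /= !mulrDl -!scalerAl.
by rewrite !scalerBr !opprD [X in X + _ = _]addrACA [LHS]addrACA.
Qed.

HB.instance Definition _ f := GRing.isLinear.Build F A 'End(A) _
  (leibniz_fun f) (leibniz_fun_is_linear f).

Definition leibniz_defect (f : 'End(A)) : 'Hom(A, 'End(A)) :=
  linfun (leibniz_fun f).

Lemma leibniz_defectE f x y :
  leibniz_defect f x y = f (x * y) - f x * y - x * f y.
Proof. by rewrite lfunE /= leibniz_funE. Qed.

Fact leibniz_defect_is_linear : linear leibniz_defect.
Proof.
move=> c f g; apply/lfunP=> x; apply/lfunP=> y.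
have fgE z : (c *: f + g) z = c *: f z + g z by rewrite add_lfunE scale_lfunE.
rewrite leibniz_defectE [X in _ = fun_of_lfun X _]add_lfunE scale_lfunE.
rewrite [RHS]add_lfunE scale_lfunE !leibniz_defectE !fgE.
rewrite mulrDl mulrDr -scalerAl -scalerAr.
by rewrite !scalerBr !opprD [X in X + _ = _]addrACA [LHS]addrACA.
Qed.

HB.instance Definition _ := GRing.isLinear.Build F 'End(A) 'Hom(A, 'End(A)) _
  leibniz_defect leibniz_defect_is_linear.

Definition Der : {vspace 'End(A)} := lker (linfun leibniz_defect).

Lemma memDerP (f : 'End(A)) :
  reflect (forall x y, f (x * y) = f x * y + x * f y) (f \in Der).
Proof.
have -> : (f \in Der) = (leibniz_defect f == 0) by rewrite memv_ker lfunE.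
apply: (iffP eqP) => [f0 x y | fM].
  have := leibniz_defectE f x y; rewrite f0 !zero_lfunE => /esym/eqP.
  by rewrite -addrA -opprD subr_eq0 => /eqP.
apply/lfunP=> x; apply/lfunP=> y.
by rewrite leibniz_defectE fM -addrA -opprD subrr !zero_lfunE.
Qed.

(* Der is exactly the space of F-derivations of A. *)
Lemma memDer_Fderivation (f : 'End(A)) : f \in Der <-> is_Fderivation f.
Proof.
split=> [/memDerP fM | [_ fM _]]; last by apply/memDerP.
split=> // [x y | c]; first exact: linearD.
have f1 : f 1 = 0.
  by apply: (addrI (f 1)); rewrite addr0 -{3}[1]mulr1 fM mulr1 mul1r.
by rewrite linearZ /= f1 scaler0.
Qed.

Lemma Fderivation_lfun (d : A -> A) :
  is_Fderivation d -> exists2 f : 'End(A), f \in Der & f =1 d.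
Proof.
move=> [dD dM dc].
have d_lin : linear d.
  by move=> c x y; rewrite dD -mulr_algl dM dc mul0r add0r mulr_algl.
pose dL : {linear A -> A} := HB.pack d (GRing.isLinear.Build F A A _ d d_lin).
have fE : linfun dL =1 d by move=> x; rewrite lfunE.
by exists (linfun dL) => //; apply/memDerP=> x y; rewrite !fE.
Qed.

(* A derivation d_(u, v) is the one with d a = u and d b = v, so the set
   {d_(u, v) | (u, v) \in S} is a basis of Der when the elements of some basis
   of Der take on (a, b) exactly the pairs of values listed in S. This includes
   the existence of each d_(u, v); uniqueness holds since in our use a and b are
   units that, together with their inverses, generate A. *)
Definition Der_basis_on (a b : A) (S : seq (A * A)) : Prop :=
  exists2 X : seq 'End(A),
    basis_of Der X & [seq (d a, d b) | d : 'End(A) <- X] =i S.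

End Derivations.

(* "\isog Grp (...)" characterizes the largest finite quotient of the presented
   group; the latter is finite here (of order 8n), hence isomorphic to gT. The
   generators x and y are bound in that clause, so the other clauses state that
   a and b generate gT and satisfy the relations; any such pair is the image of
   the canonical generators under an isomorphism, since gT is finite. *)
Definition is_V8n (n : nat) (gT : finGroupType) (a b : gT) : Prop :=
  [/\ ([set: gT] \isog Grp (x : y : x ^+ (2 * n), y ^+ 4,
                            y * x = x^-1 * y^-1, y^-1 * x = x^-1 * y))%g,
      <<[set a; b]>>%g = [set: gT],
      (a ^+ (2 * n) = 1 /\ b ^+ 4 = 1)%g,
      (b * a = a^-1 * b^-1)%g
    & (b^-1 * a = a^-1 * b)%g].

(* In the families below, a and b are elements of the algebra; for k >= 1 the
   truncated subtractions 2 * k - 1 and 2 * k - 2 are exact. *)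
Section Families.

Variables (R : unitRingType) (n : nat) (a b : R).

Definition family (m : nat) (E : nat -> seq (R * R)) : seq (R * R) :=
  flatten [seq E k | k <- iota 1 m].

Definition B1 := family ((n - 1) %/ 2) (fun k =>
  [:: ((a ^- (2 * k) - a ^+ (2 * k)) * b, 0);
      ((a ^+ (2 * k - 1) - a ^- (2 * k + 1)) * b, a ^+ (2 * k) - a ^- (2 * k));
      ((a ^- (2 * k) - a ^+ (2 * k)) * b ^+ 3, 0);
      ((a ^+ (2 * k - 1) - a ^- (2 * k + 1)) * b ^+ 3,
       (a ^+ (2 * k) - a ^- (2 * k)) * b ^+ 2);
      (0, (a ^+ (2 * k) - a ^- (2 * k)) * b);
      (0, (a ^+ (2 * k) - a ^- (2 * k)) * b ^+ 3)]).

Definition B2 := family ((n + 1) %/ 2) (fun k =>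
  [:: ((a ^+ (2 * k - 2) - a ^- (2 * k) * b ^+ 2) * b,
       a ^+ (2 * k - 1) - a ^- (2 * k - 1) * b ^+ 2);
      (0, (a ^+ (2 * k - 1) - a ^- (2 * k - 1) * b ^+ 2) * b)]).

(* ceil ((n - 1) / 2) = floor (n / 2) *)
Definition B3 := family (n %/ 2) (fun k =>
  [:: ((a ^- (2 * k) - a ^+ (2 * k - 2) * b ^+ 2) * b,
       a ^- (2 * k - 1) - a ^+ (2 * k - 1) * b ^+ 2);
      (0, (a ^- (2 * k - 1) - a ^+ (2 * k - 1) * b ^+ 2) * b)]).

Definition B4 := family n (fun k =>
  [:: ((a ^- (2 * k - 1) - a ^+ (2 * k - 1) * b ^+ 2) * b, 0)]).

Definition B1' := family ((n - 1) %/ 2) (fun k =>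
  [:: ((a ^+ (2 * k - 1) - a ^- (2 * k + 1)) * b, a ^+ (2 * k) - a ^- (2 * k));
      (a ^+ (2 * k + 1) - a ^- (2 * k - 1),
       (a ^+ (2 * k) - a ^- (2 * k)) * b);
      ((a ^+ (2 * k - 1) - a ^- (2 * k + 1)) * b ^+ 3,
       (a ^+ (2 * k) - a ^- (2 * k)) * b ^+ 2);
      ((a ^+ (2 * k + 1) - a ^- (2 * k - 1)) * b ^+ 2,
       (a ^+ (2 * k) - a ^- (2 * k)) * b ^+ 3);
      ((a ^- (2 * k) - a ^+ (2 * k)) * b ^+ 3, 0);
      ((a ^- (2 * k) - a ^+ (2 * k)) * b, 0);
      ((a ^- (2 * k - 1) - a ^+ (2 * k + 1)) * b ^+ 2, 0);
      (a ^- (2 * k - 1) - a ^+ (2 * k + 1), 0)]).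

Definition B2' := family ((n + 1) %/ 2) (fun k =>
  [:: ((a ^+ (2 * k - 2) - a ^- (2 * k) * b ^+ 2) * b,
       a ^+ (2 * k - 1) - a ^- (2 * k - 1) * b ^+ 2);
      (a ^+ (2 * k) - a ^- (2 * k - 2) * b ^+ 2,
       (a ^+ (2 * k - 1) - a ^- (2 * k - 1) * b ^+ 2) * b)]).

Definition B3' := family (n %/ 2) (fun k =>
  [:: ((a ^- (2 * k) - a ^+ (2 * k - 2) * b ^+ 2) * b,
       a ^- (2 * k - 1) - a ^+ (2 * k - 1) * b ^+ 2);
      (a ^- (2 * k - 2) - a ^+ (2 * k) * b ^+ 2,
       (a ^- (2 * k - 1) - a ^+ (2 * k - 1) * b ^+ 2) * b)]).

Definition B4' := family n (fun k =>
  [:: ((a ^- (2 * k - 1) - a ^+ (2 * k - 1) * b ^+ 2) * b, 0);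
      (a ^- (2 * k - 2) - a ^+ (2 * k) * b ^+ 2, 0)]).

End Families.

(* Main.v *)
Require Import Defs.
From HB Require Import structures.
From mathcomp Require Import all_boot all_order all_algebra all_fingroup.
From mathcomp Require Import all_solvable all_field.
From mathcomp Require Import zify.

Set Implicit Arguments.
Unset Strict Implicit.
Unset Printing Implicit Defensive.

Import GRing.Theory.
Local Open Scope ring_scope.

(* Write x = a, y = b and z = b^2, a central involution, and let A be the space
   of all w in F<a, z> with y w = - w y. As 2 is invertible, a derivation d
   kills z. Differentiating y^2 = z and x y x = z y then shows that
     d x = x r + (x^-1 f + s) y,   d y = f + g y   with r, s, f, g in A,
   and differentiating x^(2n) = 1 gives 2n r = 0. Conversely, inner derivations
   yield all triples (s, f, g) with r = 0; when p divides n, the map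
   h |-> chi(h) r h, where chi(a^i b^j) = i is a crossed homomorphism to F,
   yields every r. A basis of A consists of the elements h - b h b^-1, for h in
   a set of representatives of the two-element orbits of conjugation by b on
   <a, z>, and the pairs listed in the theorem are, up to sign, the images of
   these basis elements under w |-> s, f, g or r (in characteristic dividing n,
   the g-image is replaced by the sum of the g- and r-images). Counting the
   orbits requires that the group have order 8n, which follows from a
   permutation model of the presentation. *)

(** * A permutation group of order at least 8n that satisfies the presentation *)

Section Model.

Variable n : nat.
Hypothesis n_gt0 : (0 < n)%N.

Local Notation model := ('Z_(2 * n) * bool * bool)%type.

(* Right multiplication by a and by b on the normal forms a^i b^(2j) b^l,
   encoded as (i, j, l). *)
Definition rmul_a (w : model) : model :=
  let: (i, j, l) := w in (if l then i - 1 else i + 1, j (+) l, l).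

Definition rmul_b (w : model) : model :=
  let: (i, j, l) := w in (i, j (+) l, ~~ l).

Lemma rmul_a_inj : injective rmul_a.
Proof.
move=> [[i j] l] [[i' j'] l'] /= [+ + e]; rewrite -{}e.
by case: l => [/addIr-> /addIb->|/addIr-> /addIb->].
Qed.

Lemma rmul_b_inj : injective rmul_b.
Proof.
by move=> [[i j] l] [[i' j'] l'] /= [-> + /negb_inj e]; rewrite -e => /addIb->.
Qed.

Local Notation A := (perm rmul_a_inj).
Local Notation B := (perm rmul_b_inj).

(** Since [b * a = a^-1 * b^2 * b], each multiplication by a to the right of a factor b lowers the
    exponent and toggles [j]; hence the parity of [m] enters only when [l] holds. *)
Lemma perm_aX m (i : 'Z_(2 * n)) (j l : bool) :
  (A ^+ m)%g (i, j, l) =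
    (if l then i - m%:R else i + m%:R, j (+) (l && odd m), l).
Proof.
elim: m => [|m IH].
  by rewrite expg0 perm1 subr0 addr0 andbF addbF if_same.
rewrite expgSr permM IH permE /= -natr1; case: l {IH} => /=.
  by rewrite -addbA addbT opprD addrA.
by rewrite addrA addbF.
Qed.

Lemma perm_b2X m (i : 'Z_(2 * n)) (j l : bool) :
  ((B ^+ 2) ^+ m)%g (i, j, l) = (i, j (+) odd m, l).
Proof.
elim: m => [|m IH]; first by rewrite expg0 perm1 addbF.
rewrite expgSr permM IH expgS expg1 permM permE /= permE /=.
by case: j l (odd m) {IH} => [] [] [].
Qed.

Lemma perm_a_order : (A ^+ (2 * n) = 1)%g.
Proof.
apply/permP=> -[[i j] l]; rewrite perm_aX perm1 pchar_Zp ?subr0 ?addr0 ?if_same.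
  by have -> : odd (2 * n) = false; rewrite ?oddM // andbF addbF.
(* ['Z_(2 * n)] is the ring of integers modulo 2n only for 2n > 1, which follows from n > 0. *)
by case: n n_gt0 => // k _; rewrite mul2n.
Qed.

Lemma perm_b_order : (B ^+ 4 = 1)%g.
Proof.
by apply/permP=> -[[i j] l]; rewrite (expgM B 2 2) perm_b2X perm1 addbF.
Qed.

Lemma perm_relation1 : (B * A = A^-1 * B^-1)%g.
Proof.
apply/eqP; rewrite -invMg eq_sym eq_invg_mul; apply/eqP/permP=> -[[i j] l].
rewrite !permM !permE /=.
by case: j l => [] []; rewrite /= ?addrK ?subrK.
Qed.

Lemma perm_relation2 : (B^-1 * A = A^-1 * B)%g.
Proof.
have -> : (B^-1 = B * B * B)%g.
  by apply: (mulgI B); rewrite mulgV -perm_b_order !expgS expg0 mulg1 !mulgA.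
apply: (mulgI A); rewrite mulKVg; apply/permP=> -[[i j] l].
rewrite !permM !permE /=.
by case: j l => [] []; rewrite /= ?addrK ?subrK.
Qed.

(** The generated group moves the normal form of 1 to every one of the 8n points, and an orbit has
    at most as many points as the group has elements. *)
Lemma card_model_le : (8 * n <= #|<<[set A; B]>>%g|)%N.
Proof.
have -> : (8 * n = #|{: model}|)%N.
  rewrite !card_prod card_bool card_ord Zp_cast; first by rewrite ![(_ * 2)%N]mulnC !mulnA.
  by case: n n_gt0 => // k _; rewrite mul2n.
rewrite -cardsT.
pose at_one (s : {perm model}) : model := s (0, false, false).
apply: leq_trans (leq_imset_card at_one _).
apply/subset_leq_card/subsetP=> -[[i j] l] _; apply/imsetP.
have gA : A \in <<[set A; B]>>%g by rewrite mem_gen ?set21.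
have gB : B \in <<[set A; B]>>%g by rewrite mem_gen ?set22.
exists (A ^+ i * (B ^+ 2) ^+ j * B ^+ l)%g; first by rewrite !groupM ?groupX.
rewrite /at_one !permM perm_aX perm_b2X add0r natr_Zp /=.
by case: l; rewrite ?perm1 ?permE /= oddb ?addbF.
Qed.

Lemma model_homg_V8n :
  (<<[set A; B]>> \homg Grp (x : y : x ^+ (2 * n), y ^+ 4,
                            y * x = x^-1 * y^-1, y^-1 * x = x^-1 * y))%g.
Proof.
apply/existsP; exists (A, B); rewrite /= !xpair_eqE perm_a_order perm_b_order.
rewrite perm_relation1 perm_relation2 !eqxx !andbT.
by rewrite joing_idl joing_idr.
Qed.

End Model.

(** By the universal property of the presentation, the permutation group of the model is a
    homomorphic image of [gT]. *)
Lemma card_V8n_ge (n : nat) (gT : finGroupType) (a b : gT) :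
  (0 < n)%N -> is_V8n n a b -> (8 * n <= #|gT|)%N.
Proof.
move=> n_gt0 [isoG _ _ _ _]; apply: leq_trans (card_model_le n_gt0) _.
have := model_homg_V8n n_gt0; rewrite -isoG => /homgP[f <-].
by rewrite -cardsT leq_morphim.
Qed.

(** * Normal forms [a^i z^j b^l] and their multiplication *)

Section Group.

Variables (n : nat) (gT : finGroupType) (a b : gT).
Hypotheses (n_gt0 : (0 < n)%N) (V8n : is_V8n n a b).

Local Open Scope group_scope.

(* Locked, so that rewriting does not see z8 as the product b * b. *)
Definition z8 := locked (b ^+ 2).
Local Notation z := z8.

Lemma z8E : z = b ^+ 2. Proof. by rewrite /z8 -lock. Qed.

Definition word (i j : nat) (l : bool) : gT := a ^+ i * z ^+ j * b ^+ l.

Lemma a_order : a ^+ (2 * n) = 1. Proof. by case: V8n => _ _ []. Qed.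

Lemma z_order : z ^+ 2 = 1.
Proof. by case: V8n => _ _ [_ b4] _ _; rewrite z8E -expgM. Qed.

Lemma zV : z^-1 = z.
Proof. by apply: (mulgI z); rewrite mulgV; apply/esym/z_order. Qed.

Lemma bV : b^-1 = z * b.
Proof.
have e : b * (z * b) = z ^+ 2 by rewrite z8E !expgS !expg0 !mulg1 !mulgA.
by apply: (mulgI b); rewrite mulgV e z_order.
Qed.

Lemma comm_zb : commute z b. Proof. by rewrite z8E; exact/commute_sym/commuteX. Qed.

(** The two relations are linked by [b^-1 * a = z^-1 * (b * a)]; comparing their right-hand sides
    gives [z * a^-1 * z = a^-1], which is commutation because z is an involution. *)
Lemma comm_za : commute z a.
Proof.
case: V8n => _ _ _ r1 r2.
have e : z^-1 * (a^-1 * b^-1) = a^-1 * b.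
  by rewrite -r1 -r2 z8E expgS expg1 invMg -!mulgA mulKg.
have {}e : z * a^-1 * z = a^-1.
  by apply: (mulIg b); rewrite -e zV bV !mulgA.
have := congr1 (@invg _) e; rewrite !invMg zV !invgK => {}e.
apply/commute_sym/(mulgI z); rewrite e mulgA.
by have /= -> : z * z = 1 := z_order; rewrite mul1g.
Qed.

Lemma ba : b * a = a^-1 * z * b.
Proof. by case: V8n => _ _ _ -> _; rewrite bV mulgA. Qed.

Lemma aV : a^-1 = a ^+ (2 * n - 1).
Proof.
apply: (mulgI a); rewrite mulgV -expgS subn1 prednK ?a_order //.
by rewrite muln_gt0.
Qed.

Definition conjb (g : gT) : gT := b * g * b^-1.

Lemma conjbM g h : conjb (g * h) = conjb g * conjb h.
Proof. by rewrite /conjb !mulgA mulgKV. Qed.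

Lemma conjb1 : conjb 1 = 1. Proof. by rewrite /conjb mulg1 mulgV. Qed.

Lemma conjbX g m : conjb (g ^+ m) = conjb g ^+ m.
Proof. by elim: m => [|m IH]; rewrite ?conjb1 // !expgS conjbM IH. Qed.

Lemma conjb_a : conjb a = a^-1 * z.
Proof. by rewrite /conjb ba mulgK. Qed.

Lemma conjb_z : conjb z = z.
Proof. by rewrite /conjb -comm_zb mulgK. Qed.

Lemma mul_b g : b * g = conjb g * b.
Proof. by rewrite /conjb mulgKV. Qed.

(** Conjugation by b sends a to [a^-1 * z], so each factor a contributes one z. Exponents are
    natural numbers, whence [2 * n - 1] in the role of -1. *)
Lemma conjb_word i j : conjb (word i j false) = word ((2 * n - 1) * i) (i + j) false.
Proof.
rewrite /word !mulg1 conjbM (conjbX a) (conjbX z) conjb_a conjb_z aV expgMn; last first.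
  exact/commute_sym/commuteX/comm_za.
by rewrite -expgM expgD !mulgA.
Qed.

Lemma comm_word0 i j i' j' :
  word i j false * word i' j' false = word (i + i') (j + j') false.
Proof.
rewrite /word !mulg1 !expgD -!mulgA; congr (_ * _); rewrite !mulgA; congr (_ * _).
exact/commuteX2/comm_za.
Qed.

Lemma word0_mul i j i' j' l :
  word i j false * word i' j' l = word (i + i') (j + j') l.
Proof.
have wE k m : word k m l = word k m false * b ^+ l by rewrite /word mulg1.
by rewrite !wE mulgA comm_word0.
Qed.

(** Moving b past [a^i' z^j'] inverts the power of a and produces [z^i']; if [l] holds, the two
    factors b merge into one more z. *)
Lemma word1_mul i j i' j' l : word i j true * word i' j' l =
  word (i + (2 * n - 1) * i') (j + (i' + j' + l)) (~~ l).
Proof.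
have wE k m l' : word k m l' = word k m false * b ^+ l' by rewrite /word mulg1.
have mE (x y v : gT) : (x * b) * (y * v) = x * conjb y * (b * v).
  by rewrite -mulgA (mulgA b) (mul_b y) !mulgA.
rewrite [word i' _ _]wE [word i j _]wE expg1 mE conjb_word comm_word0.
case: l => /=; last by rewrite expg0 mulg1 addn0 [RHS]wE.
have -> : b * b ^+ true = z by rewrite z8E.
by rewrite /word !mulg1 -mulgA -expgSr addn1 addnS.
Qed.

Lemma word_mod i j l : word i j l = word (i %% (2 * n)) (odd j) l.
Proof.
rewrite /word; congr (_ * _ * _); first by rewrite expg_mod // a_order.
by rewrite -modn2 expg_mod // z_order.
Qed.

Definition normal_form (w : 'I_(2 * n) * bool * bool) : gT :=
  word w.1.1 w.1.2 w.2.

Lemma word_normal_form i j l : word i j l \in codom normal_form.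
Proof.
have lt2n : (i %% (2 * n) < 2 * n)%N by rewrite ltn_mod muln_gt0.
rewrite word_mod; apply/codomP.
by exists (Ordinal lt2n, odd j, l).
Qed.

(** The normal forms contain 1, a and b and are closed under products, so they exhaust the group
    generated by a and b. *)
Lemma codom_normal_form g : g \in codom normal_form.
Proof.
have K_group : group_set [set g in codom normal_form].
  apply/group_setP; split=> [|g1 g2]; rewrite !inE.
    have -> : 1 = word 0 0 false by rewrite /word !mulg1.
    exact: word_normal_form.
  case/codomP=> -[[i j] l] ->; case/codomP=> -[[i' j'] l'] ->.
  rewrite /normal_form /=; case: l; rewrite ?word1_mul ?word0_mul;
    exact: word_normal_form.
case: V8n => _ gen_ab _ _ _; have : g \in <<[set a; b]>> by rewrite gen_ab inE.
move/(subsetP (_ : _ \subset Group K_group)); rewrite inE; apply.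
rewrite gen_subG; apply/subsetP=> h; rewrite !inE => /orP[]/eqP->.
  have -> : a = word 1 0 false by rewrite /word !mulg1.
  exact: word_normal_form.
have -> : b = word 0 0 true by rewrite /word !mul1g.
exact: word_normal_form.
Qed.

(** A surjection from a set of 8n elements onto a group of order at least 8n is injective. *)
Lemma normal_form_inj : injective normal_form.
Proof.
apply/injectiveP/card_uniqP; rewrite size_codom.
have cE : #|codom normal_form| = #|gT|.
  by apply: eq_card => g; rewrite codom_normal_form.
apply/eqP; rewrite cE eqn_leq; apply/andP; split.
  by rewrite -cE (leq_trans (card_size _)) ?size_codom.
rewrite !card_prod card_ord card_bool (leq_trans _ (card_V8n_ge n_gt0 V8n)) //.
by rewrite ![(_ * 2)%N]mulnC !mulnA.
Qed.

Lemma wordP g : exists i j l, g = word i j l.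
Proof.
by case/codomP: (codom_normal_form g) => -[[i j] l] ->; exists i, j, l.
Qed.

Lemma word_eq i j l i' j' l' : word i j l = word i' j' l' ->
  [/\ i = i' %[mod 2 * n], odd j = odd j' & l = l'].
Proof.
have lt2n k : (k %% (2 * n) < 2 * n)%N by rewrite ltn_mod muln_gt0.
rewrite word_mod [RHS]word_mod => e.
have: (Ordinal (lt2n i), odd j, l) = (Ordinal (lt2n i'), odd j', l').
  exact: normal_form_inj.
by case.
Qed.

Definition parts (g : gT) : 'I_(2 * n) * bool * bool := iinv (codom_normal_form g).
(** True exactly outside the subgroup generated by a and [b^2]; the elements where it is false are
    the rotations. *)
Definition reflb (g : gT) : bool := (parts g).2.
Definition exponent (g : gT) : nat := (parts g).1.1.

Lemma parts_word i j l : normal_form (parts (word i j l)) = word i j l.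
Proof. exact: f_iinv. Qed.

Lemma reflb_word i j l : reflb (word i j l) = l.
Proof. by have [] := word_eq (parts_word i j l). Qed.

Lemma exponent_word i j l : exponent (word i j l) = i %[mod 2 * n].
Proof. by have [] := word_eq (parts_word i j l). Qed.

Lemma reflbM g h : reflb (g * h) = reflb g (+) reflb h.
Proof.
have [i [j [l ->]]] := wordP g; have [i' [j' [l' ->]]] := wordP h.
by case: l; rewrite ?word1_mul ?word0_mul !reflb_word.
Qed.

(** Applying it twice is conjugation by [b^2], which is central. *)
Lemma conjbK : involutive conjb.
Proof.
move=> g; have [i [j [l ->]]] := wordP g.
have cz : commute z (word i j l).
  do 2?apply: commuteM; apply: commuteX => //; [exact: comm_za|exact: comm_zb].
have -> : conjb (conjb (word i j l)) = z * word i j l * z^-1.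
  by rewrite /conjb z8E expgS expg1 invMg !mulgA.
by rewrite cz mulgK.
Qed.

End Group.

(** * Orbits of conjugation by b on the subgroup generated by a and [b^2] *)

Section Orbits.

Variables (n : nat) (gT : finGroupType) (a b : gT).
Hypotheses (n_gt0 : (0 < n)%N) (V8n : is_V8n n a b).

Local Open Scope group_scope.
Local Notation z := (z8 b).
Local Notation conjb := (conjb b).
Local Notation word := (word a b).

Lemma conjbV g : conjb g^-1 = (conjb g)^-1.
Proof. by rewrite /conjb !invMg invgK mulgA. Qed.

Lemma conjb_aX m : conjb (a ^+ m) = a ^- m * z ^+ m.
Proof.
rewrite (conjbX b) (conjb_a V8n) expgMn ?expgVn //.
exact/commute_sym/commuteV/(comm_za V8n).
Qed.

Lemma conjb_aN m : conjb (a ^- m) = a ^+ m * z ^+ m.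
Proof.
rewrite conjbV conjb_aX invMg invgK -expgVn (zV V8n).
exact/commuteX2/(comm_za V8n).
Qed.

Lemma conjb_z_mul g : conjb (z * g) = z * conjb g.
Proof. by rewrite conjbM (conjb_z b). Qed.

Definition even_orbits : seq gT := [seq a ^+ (2 * k) | k <- iota 1 ((n - 1) %/ 2)].
(** An odd power [a^m] is conjugate to [a^-m * z], so every orbit with odd exponents contains
    exactly one odd power of a without the factor z. The n such powers are listed with exponents of
    both signs, as in the families of the theorem. *)
Definition odd_orbits : seq gT :=
  [seq a ^+ (2 * k - 1) | k <- iota 1 ((n + 1) %/ 2)]
    ++ [seq a ^- (2 * k - 1) | k <- iota 1 (n %/ 2)].

(* One element from each two-element orbit of conjb on <a, b^2>. *)
Definition orbit_reps : seq gT :=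
  even_orbits ++ [seq z * g | g <- even_orbits] ++ odd_orbits.

(** Conjugation by b multiplies [a^n] by [z^n], so [a^n] is fixed only for even n. *)
Definition fixed_points : seq gT :=
  [:: 1; z] ++ (if odd n then [::] else [:: a ^+ n; z * a ^+ n]).

Lemma aX_opp m k : (m + k = 2 * n)%N -> a ^+ m = a ^- k.
Proof.
move=> mk; apply: (mulIg (a ^+ k)); rewrite mulVg -expgD mk; exact: a_order V8n.
Qed.

Lemma mem_odd_orbits k : (0 < k <= n)%N -> a ^+ (2 * k - 1) \in odd_orbits.
Proof.
move=> /andP[k_gt0 k_le]; rewrite mem_cat.
have [k_small|k_big] := leqP k ((n + 1) %/ 2).
  by rewrite (map_f (fun k => a ^+ (2 * k - 1))) // mem_iota; lia.
rewrite (aX_opp (k := 2 * (n - k + 1) - 1)); last by lia.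
by rewrite orbC (map_f (fun k => a ^- (2 * k - 1))) // mem_iota; lia.
Qed.

Lemma mem_odd_orbitsN k : (0 < k <= n)%N -> a ^- (2 * k - 1) \in odd_orbits.
Proof.
move=> k_le; rewrite -(aX_opp (m := 2 * (n - k + 1) - 1)); last by lia.
by apply: mem_odd_orbits; lia.
Qed.

Lemma mem_even_orbits k : (0 < k <= (n - 1) %/ 2)%N -> a ^+ (2 * k) \in even_orbits.
Proof.
by move=> k_le; rewrite (map_f (fun k => a ^+ (2 * k))) // mem_iota; lia.
Qed.

Lemma mem_orbit_reps_z k (j : bool) : (0 < k <= (n - 1) %/ 2)%N ->
  z ^+ j * a ^+ (2 * k) \in orbit_reps.
Proof.
move=> k_le; rewrite !mem_cat; case: j => /=.
  by rewrite (map_f (mulg z)) ?orbT // mem_even_orbits.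
by rewrite mul1g mem_even_orbits.
Qed.

Lemma mem_orbit_reps_odd k : (0 < k <= n)%N -> a ^+ (2 * k - 1) \in orbit_reps.
Proof. by move=> k_le; rewrite /orbit_reps catA mem_cat mem_odd_orbits ?orbT. Qed.

Lemma mem_orbit_reps_oddN k : (0 < k <= n)%N -> a ^- (2 * k - 1) \in orbit_reps.
Proof. by move=> k_le; rewrite /orbit_reps catA mem_cat mem_odd_orbitsN ?orbT. Qed.

Lemma z_odd i : odd i -> z ^+ i = z.
Proof.
by move=> i_odd; rewrite -(expg_mod i (z_order V8n)) modn2 i_odd expg1.
Qed.

Lemma z_even i : ~~ odd i -> z ^+ i = 1.
Proof.
by move=> /negPf i_odd; rewrite -(expg_mod i (z_order V8n)) modn2 i_odd.
Qed.

(** The cases are the parity of the exponent i of a, then the factor z for odd i, and the position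
    of i relative to n for even i. *)
Lemma orbits_cover g : ~~ reflb n_gt0 V8n g ->
  g \in fixed_points ++ orbit_reps ++ map conjb orbit_reps.
Proof.
have [i0 [j0 [l ->]]] := wordP n_gt0 V8n g; rewrite reflb_word => /negPf->.
rewrite (word_mod V8n).
have: (i0 %% (2 * n) < 2 * n)%N by rewrite ltn_mod muln_gt0.
move: (i0 %% _)%N (odd j0) => i j lt_i {i0 j0 l}.
have -> : word i j false = z ^+ j * a ^+ i.
  by rewrite /word mulg1; apply/commuteX2/commute_sym/(comm_za V8n).
rewrite mem_cat [X in _ || X]mem_cat.
have [odd_i|even_i] := boolP (odd i).
  have [k [k_le ik]] : exists k, (0 < k <= n)%N /\ i = (2 * k - 1)%N.
    by exists i./2.+1; lia.
  case: j; rewrite ?mul1g ik ?mem_orbit_reps_odd ?orbT //.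
  (* An odd power with the factor z is the conjugate of the opposite power without it. *)
  have -> : z ^+ true * a ^+ (2 * k - 1) = conjb (a ^- (2 * k - 1)).
    rewrite conjb_aN -ik !z_odd //.
    exact: (commuteX _ (comm_za V8n)).
  by rewrite (map_f conjb) ?orbT // mem_orbit_reps_oddN.
have {even_i} ik : i = (2 * i./2)%N by lia.
move: i./2 ik lt_i => k -> lt_i {i}.
have [->|k_gt0] := posnP k; first by case: j; rewrite !inE ?mulg1 eqxx ?orbT.
have [k_small|k_big] := leqP k ((n - 1) %/ 2).
  by rewrite mem_orbit_reps_z ?orbT ?k_gt0.
have [kn|k_neq] := eqVneq (2 * k)%N n.
  have n_even : odd n = false by lia.
  rewrite /fixed_points n_even kn.
  by case: j; rewrite !inE ?expg1 ?mul1g eqxx ?orbT.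
(* Here n < 2k < 2n, so the opposite exponent 2(n - k) lies strictly between 0 and n. *)
have -> : z ^+ j * a ^+ (2 * k) = conjb (z ^+ j * a ^+ (2 * (n - k))).
  rewrite conjbM (conjbX b) (conjb_z b) conjb_aX.
  rewrite [X in _ * (_ * X)]z_even ?oddM // mulg1.
  rewrite (@aX_opp (2 * k) (2 * (n - k))) //; lia.
by rewrite (map_f conjb) ?orbT // mem_orbit_reps_z //; lia.
Qed.

Lemma size_even_orbits : size even_orbits = ((n - 1) %/ 2)%N.
Proof. by rewrite size_map size_iota. Qed.

Lemma size_odd_orbits : size odd_orbits = n.
Proof. by rewrite size_cat !size_map !size_iota; lia. Qed.

Lemma size_orbit_reps : size orbit_reps = (if odd n then 2 * n - 1 else 2 * (n - 1))%N.
Proof.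
rewrite 2!size_cat [X in (_ + (X + _))%N]size_map size_even_orbits size_odd_orbits.
by case: ifP => [|/negbT] n_odd; lia.
Qed.

(** The list covers the 4n rotations and has length 4n for either parity of n, so it has no
    repetition. *)
Lemma orbits_uniq : uniq (fixed_points ++ orbit_reps ++ map conjb orbit_reps).
Proof.
pose f (w : 'I_(2 * n) * bool) := word w.1 w.2 false.
have f_inj : injective f.
  move=> [i j] [i' j'] e.
  have := @normal_form_inj _ _ _ _ n_gt0 V8n (i, j, false) (i', j', false) e.
  by case=> -> ->.
apply: (@leq_size_uniq _ (codom f)); first exact/injectiveP.
  move=> g /codomP[w ->]; apply: orbits_cover; by rewrite reflb_word.
rewrite size_codom card_prod card_ord card_bool (size_cat fixed_points) (size_cat orbit_reps).
rewrite (size_map conjb) size_orbit_reps.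
by rewrite /fixed_points; case: ifP => [|/negbT] n_odd /=; lia.
Qed.

Lemma orbit_reps_uniq : uniq orbit_reps.
Proof. by have:= orbits_uniq; rewrite !cat_uniq => /and3P[_ _ /andP[]]. Qed.

Lemma conjb_orbit_reps g h : g \in orbit_reps -> h \in orbit_reps -> conjb g != h.
Proof.
move=> rg rh; have:= orbits_uniq; rewrite !cat_uniq => /and3P[_ _ /and3P[_ + _]].
by apply: contraNneq => e; apply/hasP; exists h => //; rewrite -e map_f.
Qed.

Lemma conjb_fixed_points g : g \in fixed_points -> conjb g = g.
Proof.
have fixn : ~~ odd n -> conjb (a ^+ n) = a ^+ n.
  move=> n_even; rewrite conjb_aX z_even // mulg1 [RHS](@aX_opp n n) //; lia.
rewrite /fixed_points; case: ifP => [_|/negbT/fixn fixan]; rewrite !inE.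
  by case/orP=> /eqP->; rewrite ?(conjb1 b) ?(conjb_z b).
case/or4P=> /eqP->; rewrite ?(conjb1 b) ?(conjb_z b) //.
by rewrite conjb_z_mul fixan.
Qed.

End Orbits.

(** * Derivations seen through their values on two elements *)

Section DerivationValues.

Variables (F : fieldType) (A : falgType F) (a b : A).

Definition Der_value (w : A * A) : Prop := exists2 d, d \in Der A & (d a, d b) = w.

Lemma Der_valueD w1 w2 : Der_value w1 -> Der_value w2 -> Der_value (w1 + w2).
Proof.
move=> [d1 D1 <-] [d2 D2 <-]; exists (d1 + d2); first exact: memvD.
by rewrite !add_lfunE.
Qed.

Lemma Der_valueZ c w : Der_value w -> Der_value (c *: w).
Proof.
move=> [d D <-]; exists (c *: d); first exact: memvZ.
by rewrite !scale_lfunE.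
Qed.

Lemma Der_valueN w : Der_value w -> Der_value (- w).
Proof. by rewrite -scaleN1r; apply: Der_valueZ. Qed.

Lemma Der_inner w : Der_value (w * a - a * w, w * b - b * w).
Proof.
exists (amull w - amulr w)%VF; last by rewrite !add_lfunE !opp_lfunE !lfunE.
apply/memDerP=> x y; rewrite !add_lfunE !opp_lfunE !lfunE /=.
by rewrite mulrBl mulrBr !mulrA addrA subrK.
Qed.

Lemma ex_eval : exists ev : 'Hom('End(A), (A * A)%type), forall d, ev d = (d a, d b).
Proof.
pose e (d : 'End(A)) := (d a, d b).
have e_lin : linear e by move=> c d d'; rewrite /e !add_lfunE !scale_lfunE.
pose eL : {linear 'End(A) -> (A * A)%type} :=
  HB.pack e (GRing.isLinear.Build F 'End(A) (A * A)%type _ e e_lin).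
by exists (linfun eL) => d; rewrite lfunE.
Qed.

(** Lift [S] to a list [X] of derivations. The values of all derivations lie in the span of [T],
    hence in that of [S], so by injectivity of evaluation [X] spans. As [T] is free of the same size
    as [S], the span of [S] has dimension at least [size X], so [X] is a basis. *)
Lemma Der_basis_onP (S T : seq (A * A)) :
    (forall d, d \in Der A -> d a = 0 -> d b = 0 -> d = 0) ->
    (forall w, w \in S -> Der_value w) ->
    (forall d, d \in Der A -> (d a, d b) \in <<T>>%VS) ->
    free T -> {subset T <= <<S>>%VS} -> size S = size T ->
  \dim (Der A) = size T /\ Der_basis_on a b S.
Proof.
move=> Der_inj S_Der Der_T T_free T_S sST; have [ev evE] := ex_eval.
have [X X_Der evX] : exists2 X, {subset X <= Der A} & map ev X = S.
  elim: S S_Der {T_S sST} => [|w S IH] S_Der; first by exists [::].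
  have [|X X_Der evX] := IH; first by move=> v Sv; apply: S_Der; rewrite inE Sv orbT.
  have [d D dw] := S_Der w (mem_head _ _).
  exists (d :: X); last by rewrite /= evX evE dw.
  by move=> d'; rewrite inE => /orP[/eqP->|/X_Der].
have T_sub : (<<T>> <= <<S>>)%VS by apply/span_subvP.
have dS : (size S <= \dim <<S>>)%N.
  by rewrite sST -(eqP T_free); apply: dimvS.
have X_span : (<<X>> = Der A)%VS.
  apply/eqP; rewrite eqEsubv; apply/andP; split; first exact/span_subvP.
  apply/subvP=> d D; have := subvP T_sub _ (Der_T d D).
  rewrite -evX -limg_span => /memv_imgP[d' Xd' e].
  have D' : d' \in Der A by apply: (subvP _ _ Xd'); apply/span_subvP.
  move: e; rewrite evE => -[ea eb].
  suff /eqP : d - d' = 0 by rewrite subr_eq0 => /eqP->.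
  by apply: Der_inj; rewrite ?memvB // add_lfunE opp_lfunE (ea, eb) subrr.
have X_size : size X = size S by rewrite -evX size_map.
have X_dim : (size X <= \dim (Der A))%N.
  rewrite X_size (leq_trans dS) // -evX -limg_span X_span.
  by rewrite -(limg_ker_dim ev (Der A)) leq_addl.
have X_basis : basis_of (Der A) X by rewrite basisEdim X_span subvv X_dim.
split.
  by apply/eqP; rewrite -sST -X_size eqn_leq X_dim -X_span dim_span.
by exists X => // w; rewrite -[in RHS]evX; congr (w \in _); apply: eq_map.
Qed.

End DerivationValues.

(** * Linear maps and derivations of a group algebra, given on group elements *)

Section GroupAlgebraTheory.

Variables (F : fieldType) (gT : finGroupType).
Local Notation FG := (group_algebra F gT).
Local Notation ge := (@group_elt F gT).

Lemma sum_group_elt (v : FG) : v = \sum_g v g *: ge g.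
Proof.
apply/ffunP=> h; rewrite sum_ffunE (bigD1 h) //= big1 => [|g /negPf ngh].
  by rewrite !ffunE eqxx addr0 /GRing.scale /= mulr1.
by rewrite !ffunE eq_sym ngh scaler0.
Qed.

Lemma group_eltMl h (v : FG) g : (ge h * v) g = v (h^-1 * g)%g.
Proof.
rewrite ffunE (bigD1 h) //= big1 => [|k /negPf nk]; last by rewrite ffunE nk mul0r.
by rewrite ffunE eqxx mul1r addr0.
Qed.

Lemma group_eltMr h (v : FG) g : (v * ge h) g = v (g * h^-1)%g.
Proof.
rewrite ffunE (bigD1 (g * h^-1)%g) //= big1 => [|k nk].
  by rewrite ffunE invMg invgK mulgKV eqxx mulr1 addr0.
rewrite ffunE; case: eqP => [kg|]; last by rewrite mulr0.
by case/eqP: nk; rewrite -kg invMg invgK mulKVg.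
Qed.

Lemma group_elt_unit g : ge g \is a GRing.unit.
Proof.
by apply/unitrP; exists (ge g^-1)%g; rewrite -!group_eltM mulVg mulgV.
Qed.

Lemma group_eltX g m : ge (g ^+ m)%g = ge g ^+ m.
Proof.
by elim: m => [|m IH]; rewrite ?expr0 ?group_elt1 // expgS exprS group_eltM IH.
Qed.

Lemma group_eltVX g m : ge (g ^- m)%g = ge g ^- m.
Proof. by rewrite group_eltV group_eltX. Qed.

Lemma ex_lfun_group_elt (phi : gT -> FG) :
  exists f : 'End(FG), forall g, f (ge g) = phi g.
Proof.
pose d (v : FG) : FG := \sum_g v g *: phi g.
have d_lin : linear d.
  move=> c u v; rewrite /d scaler_sumr -big_split /=; apply: eq_bigr => g _.
  by rewrite !ffunE scalerDl scalerA.
pose dL : {linear FG -> FG} := HB.pack d (GRing.isLinear.Build F FG FG _ d d_lin).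
exists (linfun dL) => h; rewrite lfunE /= /d (bigD1 h) //= big1 => [|g /negPf ng].
  by rewrite ffunE eqxx scale1r addr0.
by rewrite ffunE ng scale0r.
Qed.

Lemma memDer_group_elt (f : 'End(FG)) :
    (forall g h, f (ge (g * h)%g) = f (ge g) * ge h + ge g * f (ge h)) ->
  f \in Der FG.
Proof.
move=> fM; apply/memDerP=> u v; rewrite [u]sum_group_elt.
rewrite mulr_suml !linear_sum /= !mulr_suml -big_split /=.
apply: eq_bigr => g _; rewrite -!scalerAl !linearZ /= -!scalerAl -scalerDr.
congr (_ *: _); rewrite [v]sum_group_elt mulr_sumr !linear_sum /= !mulr_sumr -big_split /=.
apply: eq_bigr => h _; rewrite !linearZ /= -!scalerAr -scalerDr linearZ /=.
by rewrite -group_eltM fM.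
Qed.

(* If every g commutes with r up to a sign, the hypothesis says that chi is a
   crossed homomorphism for that sign. *)
Lemma Der_crossed (chi : gT -> F) (r : FG) :
    (forall g h, chi (g * h)%g *: (r * (ge g * ge h)) =
       chi g *: (r * ge g * ge h) + chi h *: (ge g * r * ge h)) ->
  exists2 f, f \in Der FG & forall g, f (ge g) = chi g *: (r * ge g).
Proof.
move=> chiM; have [f fE] := ex_lfun_group_elt (fun g => chi g *: (r * ge g)).
exists f => //; apply: memDer_group_elt => g h.
by rewrite !fE group_eltM chiM -scalerAl -scalerAr !mulrA.
Qed.

(** By the Leibniz rule the group elements killed by [d] form a subgroup. *)
Lemma Der_eq0 (d : 'End(FG)) (A : {set gT}) : d \in Der FG ->
  (forall g, g \in A -> d (ge g) = 0) -> forall g, g \in <<A>>%g -> d (ge g) = 0.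
Proof.
move=> /memDerP dM dA.
have d1 : d 1 = 0.
  by apply: (addrI (d 1)); rewrite addr0 -{3}[1]mulr1 dM mulr1 mul1r.
have K_group : group_set [set g | d (ge g) == 0].
  apply/group_setP; split=> [|g h]; rewrite !inE ?group_elt1 ?d1 //.
  by move=> /eqP dg /eqP dh; rewrite group_eltM dM dg dh mul0r mulr0 addr0.
have AK : <<A>>%g \subset Group K_group.
  by rewrite gen_subG; apply/subsetP=> g /dA dg; rewrite inE dg.
by move=> g /(subsetP AK); rewrite inE => /eqP.
Qed.

End GroupAlgebraTheory.

(** * The general shape of a derivation of the group algebra *)

Section Rotations.

Variables (n : nat) (F : fieldType) (gT : finGroupType) (a b : gT).
Hypotheses (n_gt0 : (0 < n)%N) (V8n : is_V8n n a b).
Hypothesis two_neq0 : 2%:R != 0 :> F.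

Local Notation FG := (group_algebra F gT).
Local Notation ge := (@group_elt F gT).
Local Notation x := (ge a).
Local Notation y := (ge b).
Local Notation z := (ge (z8 b)).
Local Notation reflb := (reflb n_gt0 V8n).
Local Notation conjb := (conjb b).

Lemma reflb_a : reflb a = false.
Proof.
have e : word a b 1 0 false = a by rewrite /word !mulg1.
by have:= reflb_word n_gt0 V8n 1 0 false; rewrite e.
Qed.

Lemma reflb_b : reflb b = true.
Proof.
have e : word a b 0 0 true = b by rewrite /word !mul1g.
by have:= reflb_word n_gt0 V8n 0 0 true; rewrite e.
Qed.

Lemma reflb1 : reflb 1%g = false.
Proof.
have e : word a b 0 0 false = 1%g by rewrite /word !mul1g.
by have:= reflb_word n_gt0 V8n 0 0 false; rewrite e.
Qed.

Lemma reflb_z : reflb (z8 b) = false.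
Proof. by rewrite z8E expgS expg1 reflbM reflb_b. Qed.

Lemma reflbV g : reflb g^-1%g = reflb g.
Proof.
by have := reflbM n_gt0 V8n g g^-1%g; rewrite mulgV reflb1; do 2!case: reflb.
Qed.

Lemma reflbX g m : ~~ reflb g -> ~~ reflb (g ^+ m)%g.
Proof.
by move=> rg; elim: m => [|m IH]; rewrite ?reflb1 // expgS reflbM (negPf rg) (negPf IH).
Qed.

Lemma reflb_conjb g : reflb (conjb g) = reflb g.
Proof. by rewrite /conjb !reflbM reflbV reflb_b; case: reflb. Qed.

Lemma rotation_comm g h : ~~ reflb g -> ~~ reflb h -> commute g h.
Proof.
have [i [j [l ->]]] := wordP n_gt0 V8n g; have [i' [j' [l' ->]]] := wordP n_gt0 V8n h.
rewrite !reflb_word => /negPf-> /negPf->.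
by rewrite /commute !(comm_word0 V8n) addnC [(j + _)%N]addnC.
Qed.

(* v is supported on the subgroup <a, b^2>. *)
Definition rot (v : FG) : Prop := forall g, reflb g -> v g = 0.

Lemma rot0 : rot 0. Proof. by move=> g _; rewrite ffunE. Qed.

Lemma rotD v w : rot v -> rot w -> rot (v + w).
Proof. by move=> rv rw g rg; rewrite ffunE rv ?rw ?addr0. Qed.

Lemma rotN v : rot v -> rot (- v).
Proof. by move=> rv g rg; rewrite ffunE rv ?oppr0. Qed.

Lemma rotB v w : rot v -> rot w -> rot (v - w).
Proof. by move=> rv /rotN; apply: rotD. Qed.

Lemma rotZ c v : rot v -> rot (c *: v).
Proof. by move=> rv g rg; rewrite ffunE rv ?scaler0. Qed.

Lemma rotM v w : rot v -> rot w -> rot (v * w).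
Proof.
move=> rv rw g rg; rewrite ffunE big1 // => h _.
have [rh|rh] := boolP (reflb h); first by rewrite rv ?mul0r.
by rewrite rw ?mulr0 // reflbM reflbV rg (negPf rh).
Qed.

Lemma rot_group_elt g : ~~ reflb g -> rot (ge g).
Proof. by move=> rg h rh; rewrite ffunE; case: eqP => // e; rewrite -e rh in rg. Qed.

Lemma rot_conj v : rot v -> rot (y * v * y^-1).
Proof.
move=> rv g rg; rewrite -group_eltV group_eltMr group_eltMl.
by rewrite rv // !reflbM !reflbV rg reflb_b.
Qed.

Lemma rot_comm v w : rot v -> rot w -> v * w = w * v.
Proof.
move=> rv rw; rewrite [v]sum_group_elt mulr_suml mulr_sumr; apply: eq_bigr => g _.
rewrite -scalerAl -scalerAr; have [rg|rg] := boolP (reflb g); first by rewrite rv ?scale0r.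
congr (_ *: _); apply/ffunP=> h; rewrite group_eltMl group_eltMr.
have [rh|rh] := boolP (reflb h).
  by rewrite !rw // reflbM reflbV rh (negPf rg).
by rewrite (rotation_comm _ rh) // reflbV.
Qed.

(** Together with [rot_uniq], this makes the group algebra a free left module with basis 1, [y] over
    the elements satisfying [rot], so that equations can be compared componentwise. *)
Lemma rot_split v : exists v0 v1, [/\ rot v0, rot v1 & v = v0 + v1 * y].
Proof.
pose v0 : FG := [ffun g => if reflb g then 0 else v g].
exists v0, ((v - v0) * y^-1); rewrite mulrVK ?group_elt_unit // (addrC v0) subrK.
split=> // g rg; first by rewrite ffunE rg.
rewrite -group_eltV group_eltMr ffunE ffunE ffunE reflbM reflbV reflbV rg reflb_b.
by rewrite subrr.
Qed.

Lemma rot_uniq v w : rot v -> rot w -> v + w * y = 0 -> v = 0 /\ w = 0.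
Proof.
move=> rv rw e.
have v0 : v = 0.
  apply/ffunP=> g; have [rg|rg] := boolP (reflb g); first by rewrite rv ?ffunE.
  have := congr1 (fun u : FG => u g) e; rewrite ffunE group_eltMr rw ?addr0 //.
  by rewrite reflbM reflbV reflb_b (negPf rg).
split=> //; move: e; rewrite v0 add0r => /(congr1 (fun u => u * y^-1)).
by rewrite mul0r mulrK ?group_elt_unit.
Qed.

Lemma double_eq0 (v : FG) : v + v = 0 -> v = 0.
Proof.
move=> e; apply/eqP; have: 2%:R *: v == 0 by rewrite scaler_nat mulr2n e.
by rewrite scaler_eq0 (negPf two_neq0).
Qed.

(** This is the space A of the introductory outline. *)
Definition antirot (v : FG) : Prop := rot v /\ y * v = - v * y.

Lemma antirotP v : rot v -> v + y * v * y^-1 = 0 -> antirot v.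
Proof.
move=> rv e; split=> //; move/eqP: e; rewrite addrC addr_eq0 => /eqP <-.
by rewrite mulrVK ?group_elt_unit.
Qed.

Lemma y_conj v : y * v = y * v * y^-1 * y.
Proof. by rewrite mulrVK ?group_elt_unit. Qed.

Lemma yy : y * y = z. Proof. by rewrite -group_eltM z8E. Qed.

Lemma zz : z * z = 1.
Proof. by rewrite -group_eltM -group_elt1 -(z_order V8n). Qed.

Lemma zC v : v * z = z * v.
Proof.
rewrite [v]sum_group_elt mulr_suml mulr_sumr; apply: eq_bigr => g _.
rewrite -scalerAl -scalerAr; congr (_ *: _); rewrite -!group_eltM; congr ge.
have [i [j [l ->]]] := wordP n_gt0 V8n g; apply/commute_sym.
do 2?apply: commuteM; apply: commuteX => //; [exact: comm_za V8n|exact: comm_zb].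
Qed.

Lemma yx : y * x = x^-1 * z * y.
Proof. by rewrite -group_eltV -!group_eltM (ba V8n). Qed.

Lemma yxV : y * x^-1 = x * z * y.
Proof.
rewrite -group_eltV -!group_eltM; congr ge.
by rewrite mul_b (conjbV b) (conjb_a V8n) invMg invgK (zV V8n) (comm_za V8n).
Qed.

Lemma rot_x : rot x. Proof. by apply: rot_group_elt; rewrite reflb_a. Qed.

Lemma rot_xV : rot x^-1.
Proof. by rewrite -group_eltV; apply: rot_group_elt; rewrite reflbV reflb_a. Qed.

Lemma rot_z : rot z. Proof. by apply: rot_group_elt; rewrite reflb_z. Qed.

(** Differentiating [z * z = 1] gives [2 z (d z) = 0] because z is central. *)
Lemma Der_z (d : 'End(FG)) : d \in Der FG -> d z = 0.
Proof.
move=> /memDerP dM.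
have d1 : d 1 = 0.
  by apply: (addrI (d 1)); rewrite addr0 -{3}[1]mulr1 dM mulr1 mul1r.
have: z * d z = 0.
  by apply: double_eq0; rewrite -{1}zC -dM zz.
by move/(congr1 (fun v => z * v)); rewrite mulrA zz mul1r mulr0.
Qed.

Lemma Der_shape (d : 'End(FG)) : d \in Der FG ->
  exists r s f g, [/\ [/\ antirot r, antirot s, antirot f & antirot g],
    d x = x * r + (x^-1 * f + s) * y, d y = f + g * y
    & n%:R != 0 :> F -> r = 0].
Proof.
move=> D; have dz := Der_z D; have /memDerP dM := D.
have xU := @group_elt_unit F gT a; have yU := @group_elt_unit F gT b.
have [u0 [u1 [ru0 ru1 du]]] := rot_split (d x).
have [f [g [rf rg dv]]] := rot_split (d y).
(* [c] is conjugation by [y], kept abstract so that products move past [y] only through [yc]. *)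
have [c [cE yc rc]] : exists c : FG -> FG, [/\ forall v, c v = y * v * y^-1,
    forall v, y * v = c v * y & forall v, rot v -> rot (c v)].
  by exists (fun v => y * v * y^-1); split; [|exact: y_conj|exact: rot_conj].
have anti v : rot v -> v + c v = 0 -> antirot v by rewrite cE; apply: antirotP.
have [/(anti _ rf) af /(anti _ rg) ag] : f + c f = 0 /\ g + c g = 0.
  (* These are the two components of the derivative of [y * y = z]. *)
  have e : (g + c g) * z + (f + c f) * y = 0.
    rewrite -dz -yy dM dv !mulrDl mulrDr (mulrA y) (yc f) (yc g) -!(mulrA _ y y).
    by rewrite [RHS]addrACA [RHS]addrC.
  have [] := rot_uniq _ _ e; first by apply: rotM rot_z; apply: rotD => //; apply: rc.
    by apply: rotD => //; apply: rc.
  move=> e1 e2; split=> //; rewrite -[LHS]mulr1 -zz mulrA e1 ?mul0r //.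
have rx := rot_x; have rxV := rot_xV; have rz := rot_z.
pose c0 := c u0; pose c1 := c u1.
have rc0 : rot c0 by apply: rc.
have rc1 : rot c1 by apply: rc.
have xyx : x * y * x = z * y by rewrite -mulrA yx !mulrA mulrV // mul1r.
(* The derivative of [x * y * x = z * y], sorted into its rotation part and its coefficient of
   [y]. *)
have relation : (u1 * x * z + x * f * x + x * c1 * z - z * f)
    + (u0 * x^-1 * z + x * g * x^-1 * z + x * c0 - z * g) * y = 0.
  have := congr1 d xyx; rewrite dM (dM x) (dM z) dz mul0r add0r.
  rewrite du dv.
  have -> : ((u0 + u1 * y) * y + x * (f + g * y)) * x = u0 * x^-1 * z * y + u1 * x * z
     + (x * f * x + x * g * x^-1 * z * y).
    rewrite !mulrDl mulrDr mulrDl; congr (_ + _ + (_ + _)).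
    - by rewrite -mulrA yx !mulrA.
    - by rewrite -2!mulrA [y * _]mulrA yy -mulrA zC.
    - by rewrite -2!mulrA yx !mulrA.
  have -> : x * y * (u0 + u1 * y) = x * c0 * y + x * c1 * z.
    by rewrite mulrDr -!mulrA (mulrA y u1) (yc u0) (yc u1) -!mulrA yy.
  move/eqP; rewrite -subr_eq0 => /eqP <-.
  rewrite mulrDr !mulrDl !mulNr opprD !mulrA.
  move: (u1 * x * z) (x * f * x) (x * c1 * z) (z * f) (u0 * x^-1 * z * y) => A1 A2 A3 A4 A5.
  move: (x * g * x^-1 * z * y) (x * c0 * y) (z * g * y) => A6 A7 A8.
  by rewrite [RHS](AC (2*2*2*2) (2*3*6*7*(1*4*5*8))).
have [||H Y] := rot_uniq _ _ relation; try by repeat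
  (exact || apply: rotB || apply: rotD || apply: rotM).
have cxV w : c (x^-1 * w) = x * z * c w.
  by rewrite !cE (mulrA y) yxV !mulrA.
(* The two terms in [g] cancel because rotations commute; up to the factor z, what remains says that
   [x^-1 * u0] anticommutes with [y]. *)
have {}Y : u0 * x^-1 * z + x * c0 = 0.
  by rewrite -[RHS]Y (rot_comm rx rg) mulrK // (zC g) [in RHS]addrAC addrK.
have ar : antirot (x^-1 * u0).
  apply: anti; first exact: rotM.
  rewrite cxV (rot_comm rxV ru0) -[LHS]mulr1 -zz mulrA -[RHS](mul0r z) -Y.
  by congr (_ * z); rewrite mulrDl -!mulrA (zC (c u0)) (mulrA z z) zz mul1r.
have as_ : antirot (u1 - x^-1 * f).
  apply: anti; first by apply: rotB => //; apply: rotM.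
  have cB v w : c (v - w) = c v - c w by rewrite !cE mulrBr mulrBl.
  have cf : c f = - f.
    by rewrite cE; case: af => _ ->; rewrite mulrK.
  (* Multiplying the rotation part [H] of the relation by [x^-1 * z] turns it into the required sum
     of [u1 - x^-1 * f] and its conjugate; [t1] to [t4] treat its four terms. *)
  rewrite cB cxV cf mulrN opprK -[RHS](mulr0 (x^-1 * z)) -H.
  have t1 : x^-1 * z * (u1 * x * z) = u1.
    by rewrite -(rot_comm rx ru1) (zC (x * u1)) -mulrA (mulrA z z) zz mul1r mulKr.
  have t2 : x^-1 * z * (x * f * x) = x * z * f.
    rewrite (rot_comm (rotM rx rf) rx) -mulrA -(zC (x * (x * f))) -mulrA mulKr //.
    by rewrite -mulrA (zC f) mulrA.
  have t3 : x^-1 * z * (x * c1 * z) = c1.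
    by rewrite (zC (x * c1)) -mulrA (mulrA z z) zz mul1r mulKr.
  have t4 : x^-1 * z * (z * f) = x^-1 * f.
    by rewrite -mulrA (mulrA z z) zz mul1r.
  by rewrite mulrBr 2!mulrDr t1 t2 t3 t4 [LHS](AC (2*2) (1*4*3*2)).
exists (x^-1 * u0), (u1 - x^-1 * f), f, g; split=> //.
  by rewrite mulVKr // (addrC (x^-1 * f)) subrK.
move=> n_neq0; have u0E : u0 = x * (x^-1 * u0) by rewrite mulVKr.
move: (x^-1 * u0) u0E ar => r u0E ar.
(* Only the rotation part of the derivative of a power is needed; at m = 2n it gives 2n r = 0. *)
have dX m : exists2 t, rot t & d (x ^+ m) = m%:R *: (x ^+ m * r) + t * y.
  elim: m => [|m [t rt IH]].
    exists 0; first exact: rot0.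
    have d1 : d 1 = 0.
      by apply: (addrI (d 1)); rewrite addr0 -{3}[1]mulr1 dM mulr1 mul1r.
    by rewrite scale0r mul0r addr0.
  exists (t * x^-1 * z + x ^+ m * u1).
    apply: rotD; first by apply: rotM => //; apply: rotM.
    by apply: rotM => //; rewrite -group_eltX; apply/rot_group_elt/reflbX; rewrite reflb_a.
  rewrite exprSr dM IH du {1}u0E mulrDl -scalerAl mulrDr -natr1 scalerDl scale1r.
  rewrite (mulrDl _ _ y) -!mulrA -(rot_comm rx ar.1) yx -!mulrA.
  by rewrite addrACA.
have [t rt] := dX (2 * n)%N; rewrite -group_eltX (a_order V8n) group_elt1 mul1r.
have d1 : d 1 = 0.
  by apply: (addrI (d 1)); rewrite addr0 -{3}[1]mulr1 dM mulr1 mul1r.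
rewrite d1 => /esym e; have [|+ _] := rot_uniq _ rt e.
  exact/rotZ/ar.1.
move/eqP; rewrite scaler_eq0 natrM mulf_eq0 (negPf two_neq0) (negPf n_neq0).
by move/eqP.
Qed.

End Rotations.

(** * A basis of the anticommuting rotations, and derivations realizing each kind of value *)

Section Existence.

Variables (n : nat) (F : fieldType) (gT : finGroupType) (a b : gT).
Hypotheses (n_gt0 : (0 < n)%N) (V8n : is_V8n n a b).
Hypothesis two_neq0 : 2%:R != 0 :> F.

Local Notation FG := (group_algebra F gT).
Local Notation ge := (@group_elt F gT).
Local Notation x := (ge a).
Local Notation y := (ge b).
Local Notation z := (ge (z8 b)).
Local Notation reflb := (reflb n_gt0 V8n).
Local Notation conjb := (conjb b).
Local Notation antirot := (@antirot n F gT a b n_gt0 V8n).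
Local Notation reps := (orbit_reps n a b).
Local Notation Dv := (Der_value x y).

Definition antisym (h : gT) : FG := ge h - ge (conjb h).

Lemma antisym_conjb h : antisym (conjb h) = - antisym h.
Proof. by rewrite /antisym (conjbK n_gt0 V8n) opprB. Qed.

Lemma antisym_antirot h : ~~ reflb h -> antirot (antisym h).
Proof.
move=> rh; split; first by apply: rotB; apply: rot_group_elt; rewrite ?reflb_conjb.
have e : (b * conjb h = h * b)%g by rewrite mul_b (conjbK n_gt0 V8n).
by rewrite mulrBr mulNr mulrBl opprB -!group_eltM e mul_b.
Qed.

Lemma antisym_span h : ~~ reflb h -> antisym h \in <<map antisym reps>>%VS.
Proof.
move=> /orbits_cover; rewrite mem_cat => /orP[fh|].
  by rewrite /antisym (conjb_fixed_points n_gt0 V8n fh) subrr mem0v.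
rewrite mem_cat => /orP[rh|/mapP[k rk ->]]; first by rewrite memv_span // map_f.
by rewrite antisym_conjb memvN memv_span // map_f.
Qed.

(** For such w, 2w equals [w - y * w * y^-1], which is a combination of elements [antisym g], and 2
    is invertible. *)
Lemma antirot_span w : antirot w -> w \in <<map antisym reps>>%VS.
Proof.
move=> [rw yw]; have: 2%:R *: w \in <<map antisym reps>>%VS.
  have -> : 2%:R *: w = w - y * w * y^-1.
    by rewrite yw mulrK ?group_elt_unit // opprK scaler_nat.
  rewrite [w]sum_group_elt mulr_sumr mulr_suml -sumrB; apply: memv_suml => g _.
  have [rg|rg] := boolP (reflb g); first by rewrite (rw g rg) !scale0r mulr0 mul0r subrr mem0v.
  rewrite -scalerAr -scalerAl -scalerBr memvZ //.
  by rewrite -group_eltV -!group_eltM antisym_span.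
by move/(memvZ 2%:R^-1); rewrite scalerA mulVf // scale1r.
Qed.

(** No representative is conjugate to a representative, so the coefficient at each one isolates a
    single term of a linear relation. *)
Lemma antisym_free : free (map antisym reps).
Proof.
apply/(@freeP _ _ _ (in_tuple (map antisym reps))) => k /= k0 i.
have szE : size (map antisym reps) = size reps by rewrite size_map.
have lt_i (j : 'I_(size (map antisym reps))) : (j < size reps)%N by rewrite -szE.
have := congr1 (fun v : FG => v (nth 1%g reps i)) k0.
rewrite sum_ffunE [RHS]ffunE (bigD1 i) //= big1 => [|j nij].
  rewrite (nth_map 1%g) // !ffunE eqxx addr0 eq_sym.
  rewrite (negPf (conjb_orbit_reps n_gt0 V8n _ _)) ?mem_nth // subr0.
  by rewrite /GRing.scale /= mulr1.
rewrite (nth_map 1%g) // !ffunE [_ == conjb _]eq_sym.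
rewrite (negPf (conjb_orbit_reps n_gt0 V8n _ _)) ?mem_nth // subr0.
rewrite nth_uniq // ?(orbit_reps_uniq n_gt0 V8n) //.
by rewrite val_eqE eq_sym (negPf nij) scaler0.
Qed.

(** This and the next three definitions are the pairs [(d x, d y)] obtained from the general shape
    of a derivation by keeping only s, f, g or r. *)
Definition s_value (w : FG) : FG * FG := (w * y, 0).
Definition f_value (w : FG) : FG * FG := (x^-1 * w * y, w).
Definition g_value (w : FG) : FG * FG := (0, w * y).
Definition r_value (w : FG) : FG * FG := (x * w, 0).

Local Notation ds := s_value.
Local Notation df := f_value.
Local Notation dg := g_value.
Local Notation dr := r_value.

Lemma dsN w : ds (- w) = - ds w.
Proof. by rewrite /s_value mulNr; congr (_, _); rewrite oppr0. Qed.

Lemma dfN w : df (- w) = - df w.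
Proof. by rewrite /f_value mulrN mulNr. Qed.

Lemma rep_comm g h : ~~ reflb g -> ~~ reflb h -> ge g * ge h = ge h * ge g.
Proof.
by move=> rg rh; rewrite -!group_eltM (rotation_comm rg rh).
Qed.

(** The inner derivation of h realizes it; it kills x because rotations commute. *)
Lemma Dv_dg h : ~~ reflb h -> Dv (dg (antisym h)).
Proof.
move=> rh; have := Der_inner x y (ge h); congr (Dv (_, _)).
  by rewrite rep_comm ?reflb_a // subrr.
by rewrite mulrBl -[X in _ = _ - X]group_eltM -mul_b group_eltM.
Qed.

(** These are the values of the inner derivation of [h y], split into an f-part and an s-part. *)
Lemma Dv_inner_hy h : ~~ reflb h ->
  Dv (df (antisym (z8 b * h)%g) - ds (antisym (h * a)%g)).
Proof.
move=> rh; have := Der_inner x y (ge h * y).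
have rch : ~~ reflb (conjb h) by rewrite reflb_conjb.
have -> : antisym (z8 b * h)%g = z * antisym h.
  by rewrite /antisym conjb_z_mul 2!(group_eltM F (z8 b)) mulrBr.
have -> : antisym (h * a)%g = ge h * x - ge (conjb h) * (x^-1 * z).
  rewrite /antisym conjbM (conjb_a V8n) (group_eltM F h) (group_eltM F (conjb h)).
  by rewrite (group_eltM F a^-1%g) group_eltV.
have cx w : rot n_gt0 V8n w -> w * (x^-1 * z) = x^-1 * z * w.
  move=> rw; apply: (rot_comm rw); apply: rotM; [exact: rot_xV|exact: rot_z].
congr (Dv (_, _)) => /=; last first.
  have yh : y * ge h = ge (conjb h) * y by rewrite -!(group_eltM F) mul_b.
  rewrite subr0 (mulrA y) yh -!(mulrA _ y y). by rewrite yy -mulrBl (zC n_gt0 V8n).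
rewrite -(mulrA (ge h)) (yx F V8n) (mulrA (ge h)) (cx _ (rot_group_elt _ rh)).
rewrite (cx _ (rot_group_elt _ rch)) (mulrA x) (rep_comm _ rh) ?reflb_a //.
rewrite -!mulrBl /antisym (mulrA x^-1) mulrBr opprB.
by rewrite addrA subrK.
Qed.

(** Adding the inner derivations of [h y] and of [conjb h] times [y] cancels the f-parts, since
    [antisym] changes sign under conjugation. *)
Lemma Dv_ds_step h : ~~ reflb h ->
  Dv (ds (antisym (h * a)%g) - ds (antisym (h * conjb a)%g)).
Proof.
move=> rh; have rch : ~~ reflb (conjb h) by rewrite reflb_conjb.
have := Der_valueN (Der_valueD (Dv_inner_hy rh) (Dv_inner_hy rch)).
have -> : (z8 b * conjb h = conjb (z8 b * h))%g by rewrite conjb_z_mul.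
have -> : (conjb h * a = conjb (h * conjb a))%g by rewrite conjbM (conjbK n_gt0 V8n).
rewrite !antisym_conjb dfN dsN.
have cancel_df (v w1 w2 : FG * FG) : - (v - w1 + (- v - - w2)) = w1 - w2.
  by rewrite addrACA subrr add0r opprK opprD opprK.
by rewrite cancel_df.
Qed.

(** Since [conjb a = a^-1 * z], the previous lemma links exponents of a that differ by 2, so the
    induction carries two consecutive exponents. *)
Lemma Dv_ds h : ~~ reflb h -> Dv (ds (antisym h)).
Proof.
have [i [j [l ->]]] := wordP n_gt0 V8n h; rewrite reflb_word => /negPf->.
have wS k m : word a b k.+1 m false = (word a b k m false * a)%g.
  have aE : word a b 1 0 false = a by rewrite /word !mulg1.
  by have := comm_word0 V8n k m 1 0; rewrite aE addn1 addn0 => ->.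
have wz k m : word a b k m.+1 false = (word a b k m false * z8 b)%g.
  by rewrite /word !mulg1 -mulgA -expgSr.
have rw k m : ~~ reflb (word a b k m false) by rewrite reflb_word.
have conj0 m : conjb (word a b 0 m false) = word a b 0 m false.
  by rewrite /word mul1g mulg1 (conjbX b) (conjb_z b).
have [] : (forall j, Dv (ds (antisym (word a b i j false))))
       /\ (forall j, Dv (ds (antisym (word a b i.+1 j false)))); last by [].
elim: i => [|i [IH1 IH2]]; split=> // m.
- rewrite /antisym conj0 subrr /s_value mul0r.
  by exists 0; rewrite ?mem0v // !zero_lfunE.
(* When h is a power of z, [h * a] and [h * conjb a] are conjugate; the difference is twice the
   wanted value, and 2 is invertible. *)
- have := Dv_ds_step (rw 0%N m).
  have -> : (word a b 0 m false * conjb a = conjb (word a b 1 m false))%g.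
    by rewrite wS conjbM conj0.
  rewrite -wS antisym_conjb dsN opprK => /(Der_valueZ 2%:R^-1).
  by rewrite -mulr2n -scaler_nat scalerA mulVf // scale1r.
have := Dv_ds_step (rw i.+1 m); rewrite -wS.
have -> : (word a b i.+1 m false * conjb a = word a b i m.+1 false)%g.
  by rewrite wS wz (conjb_a V8n) -mulgA mulKVg.
by move/Der_valueD/(_ (IH1 m.+1)); rewrite subrK.
Qed.

(** The inner derivation attached to [z h] in place of h has the right f-part because [z^2 = 1]; its
    s-part is removed by [Dv_ds]. *)
Lemma Dv_df h : ~~ reflb h -> Dv (df (antisym h)).
Proof.
move=> rh; have rzh : ~~ reflb (z8 b * h)%g by rewrite reflbM reflb_z (negPf rh).
have rzha : ~~ reflb (z8 b * h * a)%g by rewrite reflbM (negPf rzh) reflb_a.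
have := Der_valueD (Dv_inner_hy rzh) (Dv_ds rzha).
by rewrite subrK -{1}(zV V8n) mulKg.
Qed.

Lemma Dv_dr h : n%:R = 0 :> F -> ~~ reflb h -> Dv (dr (antisym h)).
Proof.
move=> n0 rh; pose r := antisym h; have [rr yr] := antisym_antirot rh.
pose chi g : F := (exponent n_gt0 V8n g)%:R.
(* The exponent of a is determined only modulo 2n; its image in F does not depend on the choice
   because n vanishes there. *)
have chiE i j l : chi (word a b i j l) = i%:R.
  have nat_mod m : m%:R = (m %% (2 * n))%:R :> F.
    by rewrite {1}(divn_eq m (2 * n)) natrD !natrM n0 !mulr0 add0r.
  by rewrite /chi nat_mod exponent_word -nat_mod.
have chi_minus i : ((2 * n - 1) * i)%:R = - i%:R :> F.
  by rewrite natrM natrB ?muln_gt0 // natrM n0 mulr0 sub0r mulN1r.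
have [g1 g2|f Df fE] := @Der_crossed F gT chi (antisym h).
  have [i [j [l ->]]] := wordP n_gt0 V8n g1.
  have [i' [j' [l' ->]]] := wordP n_gt0 V8n g2.
  case: l; last first.
    rewrite (word0_mul V8n) !chiE natrD scalerDl -!mulrA; congr (_ + _ *: _).
    rewrite !mulrA (rot_comm rr) //; apply: rot_group_elt; by rewrite reflb_word.
  (* Elements with a factor b anticommute with [r]; this sign matches the one that b puts on the
     exponent of the right factor of a product. *)
  have wr : ge (word a b i j true) * r = - (r * ge (word a b i j true)).
    have -> : word a b i j true = (word a b i j false * b)%g by rewrite /word mulg1.
    have rw : rot n_gt0 V8n (ge (word a b i j false)).
      by apply: rot_group_elt; rewrite reflb_word.
    by rewrite group_eltM -mulrA yr (mulrA _ (- _)) mulrN mulNr -(rot_comm rr rw) mulrA.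
  rewrite (word1_mul n_gt0 V8n) !chiE natrD scalerDl chi_minus wr mulNr mulrA.
  by rewrite scaleNr scalerN.
exists f => //; rewrite !fE /r_value.
have -> : chi a = 1 by have := chiE 1%N 0%N false; rewrite /word !mulg1.
have -> : chi b = 0 by have := chiE 0%N 0%N true; rewrite /word !mul1g.
by rewrite scale0r scale1r (rot_comm rr) //; apply: rot_x.
Qed.

End Existence.

(** * The pairs of the theorem as signed values attached to orbit representatives *)

Section Families.

Variables (n : nat) (F : fieldType) (gT : finGroupType) (a b : gT).
Hypotheses (n_gt0 : (0 < n)%N) (V8n : is_V8n n a b).

Local Notation FG := (group_algebra F gT).
Local Notation ge := (@group_elt F gT).
Local Notation x := (ge a).
Local Notation y := (ge b).
Local Notation z := (ge (z8 b)).
Local Notation ds := (@s_value F gT b).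
Local Notation df := (@f_value F gT a b).
Local Notation dg := (@g_value F gT b).
Local Notation dr := (@r_value F gT a).
Local Notation family := Defs.family.

Definition even_rep k : FG := antisym F b (a ^+ (2 * k))%g.
Definition z_even_rep k : FG := antisym F b (z8 b * a ^+ (2 * k))%g.
Definition odd_rep k : FG := antisym F b (a ^+ (2 * k - 1))%g.
Definition oddN_rep k : FG := antisym F b (a ^- (2 * k - 1))%g.

Local Notation ev := even_rep.
Local Notation evz := z_even_rep.
Local Notation od := odd_rep.
Local Notation odN := oddN_rep.

Lemma evE k : ev k = x ^+ (2 * k) - x ^- (2 * k).
Proof.
rewrite /even_rep /antisym (conjb_aX V8n) (z_even V8n (i := 2 * k)) ?oddM // mulg1.
by rewrite group_eltX group_eltVX.
Qed.

Lemma y2 : y ^+ 2 = z. Proof. by rewrite expr2 yy. Qed.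

Lemma evzE k : evz k = (x ^+ (2 * k) - x ^- (2 * k)) * y ^+ 2.
Proof.
rewrite -evE y2 (zC n_gt0 V8n) /z_even_rep /antisym conjb_z_mul 2!(group_eltM F (z8 b)).
by rewrite -mulrBr.
Qed.

Lemma odE k : (0 < k)%N -> od k = x ^+ (2 * k - 1) - x ^- (2 * k - 1) * y ^+ 2.
Proof.
move=> k_gt0; have k_odd : odd (2 * k - 1) by lia.
rewrite /odd_rep /antisym (conjb_aX V8n) (z_odd V8n (i := 2 * k - 1)) //.
by rewrite (group_eltM F (a ^- _)%g) group_eltX group_eltVX y2.
Qed.

Lemma odNE k : (0 < k)%N -> odN k = x ^- (2 * k - 1) - x ^+ (2 * k - 1) * y ^+ 2.
Proof.
move=> k_gt0; have k_odd : odd (2 * k - 1) by lia.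
rewrite /oddN_rep /antisym (conjb_aN V8n) (z_odd V8n (i := 2 * k - 1)) //.
by rewrite (group_eltM F (a ^+ _)%g) group_eltX group_eltVX y2.
Qed.

Lemma mulVx m : x^-1 * x ^+ m.+1 = x ^+ m.
Proof. by rewrite exprS mulKr ?group_elt_unit. Qed.

Lemma mulVxN m : x^-1 * x ^- m = x ^- m.+1.
Proof. by rewrite exprSr invrM ?unitrX ?group_elt_unit. Qed.

Lemma mulxN m : x * x ^- m.+1 = x ^- m.
Proof. by rewrite -mulVxN mulVKr ?group_elt_unit. Qed.

Lemma eq_family (R : unitRingType) m (E E' : nat -> seq (R * R)) :
  (forall k, (0 < k)%N -> E k = E' k) -> family m E = family m E'.
Proof.
by move=> eE; congr flatten; apply/eq_in_map => k; rewrite mem_iota => /andP[/eE].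
Qed.

(** For a positive index the truncated subtractions become successors, on which multiplication by x
    or its inverse can act. *)
Lemma pow_shift k : [/\ 2 * k.+1 - 2 = 2 * k, 2 * k.+1 - 1 = (2 * k).+1,
  2 * k.+1 + 1 = (2 * k).+3 & 2 * k.+1 = (2 * k).+2]%N.
Proof. by split; lia. Qed.

Lemma y3 (v : FG) : v * y ^+ 2 * y = v * y ^+ 3.
Proof. by rewrite -mulrA -exprSr. Qed.

Lemma Nds_ev k : ((x ^- (2 * k) - x ^+ (2 * k)) * y, 0) = - ds (ev k).
Proof. by rewrite -dsN evE opprB. Qed.

Lemma Nds_evz k : ((x ^- (2 * k) - x ^+ (2 * k)) * y ^+ 3, 0) = - ds (evz k).
Proof. by rewrite -dsN evzE -mulNr opprB /s_value y3. Qed.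

Lemma df_ev k : (0 < k)%N ->
  ((x ^+ (2 * k - 1) - x ^- (2 * k + 1)) * y, x ^+ (2 * k) - x ^- (2 * k)) = df (ev k).
Proof.
case: k => // k _; rewrite evE; have [_ -> -> ->] := pow_shift k.
by rewrite /f_value mulrBr mulVx mulVxN.
Qed.

Lemma df_evz k : (0 < k)%N ->
  ((x ^+ (2 * k - 1) - x ^- (2 * k + 1)) * y ^+ 3,
   (x ^+ (2 * k) - x ^- (2 * k)) * y ^+ 2) = df (evz k).
Proof.
case: k => // k _; rewrite evzE; have [_ -> -> ->] := pow_shift k.
by rewrite /df (mulrA x^-1) mulrBr mulVx mulVxN y3.
Qed.

Lemma dg_ev k : (0, (x ^+ (2 * k) - x ^- (2 * k)) * y) = dg (ev k).
Proof. by rewrite evE. Qed.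

Lemma dg_evz k : (0, (x ^+ (2 * k) - x ^- (2 * k)) * y ^+ 3) = dg (evz k).
Proof. by rewrite evzE /g_value y3. Qed.

Lemma df_od k : (0 < k)%N ->
  ((x ^+ (2 * k - 2) - x ^- (2 * k) * y ^+ 2) * y,
   x ^+ (2 * k - 1) - x ^- (2 * k - 1) * y ^+ 2) = df (od k).
Proof.
case: k => // k k_gt0; rewrite odE //; have [-> -> _ ->] := pow_shift k.
by rewrite /f_value mulrBr mulVx (mulrA x^-1) mulVxN.
Qed.

Lemma dg_od k : (0 < k)%N ->
  (0, (x ^+ (2 * k - 1) - x ^- (2 * k - 1) * y ^+ 2) * y) = dg (od k).
Proof. by move=> k_gt0; rewrite odE. Qed.

Lemma df_odN k : (0 < k)%N ->
  ((x ^- (2 * k) - x ^+ (2 * k - 2) * y ^+ 2) * y,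
   x ^- (2 * k - 1) - x ^+ (2 * k - 1) * y ^+ 2) = df (odN k).
Proof.
case: k => // k k_gt0; rewrite odNE //; have [-> -> _ ->] := pow_shift k.
by rewrite /f_value mulrBr mulVxN (mulrA x^-1) mulVx.
Qed.

Lemma dg_odN k : (0 < k)%N ->
  (0, (x ^- (2 * k - 1) - x ^+ (2 * k - 1) * y ^+ 2) * y) = dg (odN k).
Proof. by move=> k_gt0; rewrite odNE. Qed.

Lemma ds_odN k : (0 < k)%N ->
  ((x ^- (2 * k - 1) - x ^+ (2 * k - 1) * y ^+ 2) * y, 0) = ds (odN k).
Proof. by move=> k_gt0; rewrite odNE. Qed.

Lemma drg v : dr v + dg v = (x * v, v * y).
Proof. by rewrite /r_value /g_value; congr (_, _); rewrite ?addr0 ?add0r. Qed.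

Lemma drN v : dr (- v) = - dr v.
Proof. by rewrite /r_value mulrN; congr (_, _); rewrite oppr0. Qed.

Lemma drg_ev k : (0 < k)%N ->
  (x ^+ (2 * k + 1) - x ^- (2 * k - 1), (x ^+ (2 * k) - x ^- (2 * k)) * y)
    = dr (ev k) + dg (ev k).
Proof.
case: k => // k _; rewrite drg evE; have [_ -> -> ->] := pow_shift k.
by rewrite mulrBr -exprS mulxN.
Qed.

Lemma drg_evz k : (0 < k)%N ->
  ((x ^+ (2 * k + 1) - x ^- (2 * k - 1)) * y ^+ 2,
   (x ^+ (2 * k) - x ^- (2 * k)) * y ^+ 3) = dr (evz k) + dg (evz k).
Proof.
case: k => // k _; rewrite drg evzE; have [_ -> -> ->] := pow_shift k.
by rewrite (mulrA x) mulrBr -exprS mulxN y3.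
Qed.

Lemma Ndr_ev k : (0 < k)%N ->
  (x ^- (2 * k - 1) - x ^+ (2 * k + 1), 0) = - dr (ev k).
Proof.
case: k => // k _; rewrite -drN evE opprB; have [_ -> -> ->] := pow_shift k.
by rewrite /r_value mulrBr -exprS mulxN.
Qed.

Lemma Ndr_evz k : (0 < k)%N ->
  ((x ^- (2 * k - 1) - x ^+ (2 * k + 1)) * y ^+ 2, 0) = - dr (evz k).
Proof.
case: k => // k _; rewrite -drN evzE -mulNr opprB; have [_ -> -> ->] := pow_shift k.
by rewrite /dr (mulrA x) mulrBr -exprS mulxN.
Qed.

Lemma drg_od k : (0 < k)%N ->
  (x ^+ (2 * k) - x ^- (2 * k - 2) * y ^+ 2,
   (x ^+ (2 * k - 1) - x ^- (2 * k - 1) * y ^+ 2) * y) = dr (od k) + dg (od k).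
Proof.
case: k => // k k_gt0; rewrite drg odE //; have [-> -> _ ->] := pow_shift k.
by rewrite mulrBr -exprS (mulrA x) mulxN.
Qed.

Lemma drg_odN k : (0 < k)%N ->
  (x ^- (2 * k - 2) - x ^+ (2 * k) * y ^+ 2,
   (x ^- (2 * k - 1) - x ^+ (2 * k - 1) * y ^+ 2) * y) = dr (odN k) + dg (odN k).
Proof.
case: k => // k k_gt0; rewrite drg odNE //; have [-> -> _ ->] := pow_shift k.
by rewrite mulrBr (mulrA x) -exprS mulxN.
Qed.

Lemma dr_odN k : (0 < k)%N ->
  (x ^- (2 * k - 2) - x ^+ (2 * k) * y ^+ 2, 0) = dr (odN k).
Proof.
case: k => // k k_gt0; rewrite odNE //; have [-> -> _ ->] := pow_shift k.
by rewrite /r_value mulrBr (mulrA x) -exprS mulxN.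
Qed.

(** Signs and order follow the families of the theorem, so that [basis1E] and [basis2E] are
    equalities of sequences. *)
Definition even_values1 (c cz : FG) := [:: - ds c; df c; - ds cz; df cz; dg c; dg cz].
Definition odd_values1 (c : FG) := [:: df c; dg c].

Definition even_values2 (c cz : FG) :=
  [:: df c; dr c + dg c; df cz; dr cz + dg cz; - ds cz; - ds c; - dr cz; - dr c].
Definition odd_values2 (c : FG) := [:: df c; dr c + dg c].

Definition basis1 : seq (FG * FG) :=
  family ((n - 1) %/ 2) (fun k => even_values1 (ev k) (evz k))
  ++ family ((n + 1) %/ 2) (fun k => odd_values1 (od k))
  ++ family (n %/ 2) (fun k => odd_values1 (odN k))
  ++ family n (fun k => [:: ds (odN k)]).

Definition basis2 : seq (FG * FG) :=
  family ((n - 1) %/ 2) (fun k => even_values2 (ev k) (evz k))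
  ++ family ((n + 1) %/ 2) (fun k => odd_values2 (od k))
  ++ family (n %/ 2) (fun k => odd_values2 (odN k))
  ++ family n (fun k => [:: ds (odN k); dr (odN k)]).

Lemma basis1E : B1 n x y ++ B2 n x y ++ B3 n x y ++ B4 n x y = basis1.
Proof.
congr (_ ++ (_ ++ (_ ++ _))); apply: eq_family => k k_gt0.
- by rewrite Nds_ev Nds_evz df_ev // df_evz // dg_ev dg_evz.
- by rewrite df_od // dg_od.
- by rewrite df_odN // dg_odN.
by rewrite ds_odN.
Qed.

Lemma basis2E : B1' n x y ++ B2' n x y ++ B3' n x y ++ B4' n x y = basis2.
Proof.
congr (_ ++ (_ ++ (_ ++ _))); apply: eq_family => k k_gt0.
- by rewrite Nds_ev Nds_evz df_ev // df_evz // drg_ev // drg_evz // Ndr_ev // Ndr_evz.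
- by rewrite df_od // drg_od.
- by rewrite df_odN // drg_odN.
by rewrite ds_odN // dr_odN.
Qed.

End Families.

(** * Freeness, spanning and sizes of the families *)

Section Assembly.

Variables (n : nat) (F : fieldType) (gT : finGroupType) (a b : gT).
Hypotheses (n_gt0 : (0 < n)%N) (V8n : is_V8n n a b).
Hypothesis two_neq0 : 2%:R != 0 :> F.

Local Notation FG := (group_algebra F gT).
Local Notation ge := (@group_elt F gT).
Local Notation x := (ge a).
Local Notation y := (ge b).
Local Notation ds := (@s_value F gT b).
Local Notation df := (@f_value F gT a b).
Local Notation dg := (@g_value F gT b).
Local Notation dr := (@r_value F gT a).
Local Notation ev := (@even_rep F gT a b).
Local Notation evz := (@z_even_rep F gT a b).
Local Notation od := (@odd_rep F gT a b).
Local Notation odN := (@oddN_rep F gT a b).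
Local Notation even_values1 := (@even_values1 F gT a b).
Local Notation even_values2 := (@even_values2 F gT a b).
Local Notation odd_values1 := (@odd_values1 F gT a b).
Local Notation odd_values2 := (@odd_values2 F gT a b).
Local Notation basis1 := (@basis1 n F gT a b).
Local Notation basis2 := (@basis2 n F gT a b).
Local Notation family := Defs.family.
Local Notation reps := (map (antisym F b) (orbit_reps n a b)).
Local Notation Dv := (Der_value x y).

Lemma mem_family (R : unitRingType) m (E : nat -> seq (R * R)) k w :
  (0 < k <= m)%N -> w \in E k -> w \in family m E.
Proof.
move=> k_m wE; apply/flattenP; exists (E k) => //.
by apply: map_f; rewrite mem_iota; lia.
Qed.

Lemma family_ind (R : unitRingType) m (E : nat -> seq (R * R)) (P : R * R -> Prop) :
  (forall k, (0 < k <= m)%N -> forall w, w \in E k -> P w) ->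
  forall w, w \in family m E -> P w.
Proof.
move=> PE w /flattenP[s /mapP[k]]; rewrite mem_iota => k_m ->.
by apply: PE; lia.
Qed.

Lemma size_family (R : unitRingType) m (E : nat -> seq (R * R)) c :
  (forall k, size (E k) = c) -> size (family m E) = (m * c)%N.
Proof.
move=> sE; rewrite /Defs.family -[in RHS](size_iota 1 m).
by elim: (iota 1 m) => //= k s IH; rewrite size_cat sE IH mulSn.
Qed.

Lemma reps_ind (P : FG -> Prop) :
    (forall k, (0 < k <= (n - 1) %/ 2)%N -> P (ev k) /\ P (evz k)) ->
    (forall k, (0 < k <= (n + 1) %/ 2)%N -> P (od k)) ->
    (forall k, (0 < k <= n %/ 2)%N -> P (odN k)) ->
  forall w, w \in reps -> P w.
Proof.
have rng k m : k \in iota 1 m -> (0 < k <= m)%N by rewrite mem_iota; lia.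
move=> Pev Pod PodN w /mapP[h + ->]; rewrite mem_cat => /orP[/mapP[k /rng/Pev[? _] ->]//|].
rewrite mem_cat => /orP[/mapP[g /mapP[k /rng/Pev[_ ?] ->] ->]//|].
by rewrite mem_cat => /orP[/mapP[k /rng/Pod ? ->]|/mapP[k /rng/PodN ? ->]].
Qed.

Local Notation rotation h := (~~ reflb n_gt0 V8n h).

Lemma rotation_ev k : rotation (a ^+ (2 * k))%g.
Proof. by rewrite reflbX ?reflb_a. Qed.

Lemma rotation_evz k : rotation (z8 b * a ^+ (2 * k))%g.
Proof. by rewrite reflbM reflb_z /= reflbX ?reflb_a. Qed.

Lemma rotation_od k : rotation (a ^+ (2 * k - 1))%g.
Proof. by rewrite reflbX ?reflb_a. Qed.

Lemma rotation_odN k : rotation (a ^- (2 * k - 1))%g.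
Proof. by rewrite reflbV reflbX ?reflb_a. Qed.

(** The fourth family is written with negative exponents only; modulo 2n these reach all odd powers
    of a. *)
Lemma od_odN k : (0 < k <= n)%N -> od k = odN (n - k + 1).
Proof.
move=> k_n; rewrite /odd_rep /odN (aX_opp V8n (k := 2 * (n - k + 1) - 1)) //; lia.
Qed.

Lemma ex_lin (V W : vectType F) (phi : V -> W) : linear phi ->
  exists f : 'Hom(V, W), f =1 phi.
Proof.
move=> phi_lin.
pose phiL : {linear V -> W} := HB.pack phi (GRing.isLinear.Build F V W _ phi phi_lin).
by exists (linfun phiL) => v; rewrite lfunE.
Qed.

Lemma ds_lin : linear ds.
Proof.
move=> c v w; rewrite /s_value mulrDl -scalerAl.
by congr (_, _); rewrite /= scaler0 addr0.
Qed.

Lemma df_lin : linear df.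
Proof.
by move=> c v w; rewrite /f_value mulrDr mulrDl -scalerAr -scalerAl.
Qed.

Lemma dg_lin : linear dg.
Proof.
move=> c v w; rewrite /g_value mulrDl -scalerAl.
by congr (_, _); rewrite /= scaler0 addr0.
Qed.

Lemma dr_lin : linear dr.
Proof.
move=> c v w; rewrite /r_value mulrDr -scalerAr.
by congr (_, _); rewrite /= scaler0 addr0.
Qed.

Lemma span_map_lin (V W : vectType F) (phi : V -> W) (X : seq V) w : linear phi ->
  w \in <<map phi X>>%VS <-> exists2 v, v \in <<X>>%VS & w = phi v.
Proof.
move=> /ex_lin[f fE]; rewrite -(eq_map fE) -limg_span.
split=> [/memv_imgP[v Xv ->]|[v Xv ->]]; first by exists v.
by rewrite -fE memv_img.
Qed.

Lemma free_map_lin (V W : vectType F) (phi : V -> W) (X : seq V) : linear phi ->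
  {in <<X>>%VS, forall v, phi v = 0 -> v = 0} -> free X -> free (map phi X).
Proof.
move=> /ex_lin[f fE] phi0 X_free; rewrite -(eq_map fE) /free -limg_span size_map.
rewrite limg_dim_eq //; apply/eqP; rewrite -subv0; apply/subvP=> v.
rewrite memv_cap memv_ker => /andP[Xv /eqP fv].
by rewrite memv0 (phi0 v) // -fE.
Qed.

Lemma free_cat_disjoint (V : vectType F) (X Y : seq V) : free X -> free Y ->
  (forall v, v \in <<X>>%VS -> v \in <<Y>>%VS -> v = 0) -> free (X ++ Y).
Proof.
move=> X_free Y_free XY0; rewrite cat_free X_free Y_free /=.
apply/directv_addP/eqP; rewrite -subv0; apply/subvP=> v.
by rewrite memv_cap => /andP[Xv Yv]; rewrite memv0 (XY0 v).
Qed.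

Lemma reps_rot v : v \in <<reps>>%VS -> rot n_gt0 V8n v.
Proof.
move=> /(@coord_span _ _ _ (in_tuple reps)) ->.
apply: (big_ind (rot n_gt0 V8n)); [exact: rot0|exact: rotD|].
move=> i _; apply: rotZ; have : (in_tuple reps)`_i \in reps by rewrite mem_nth.
have antisym_rot h : rotation h -> rot n_gt0 V8n (antisym F b h).
  by move/(antisym_antirot F)=> [].
move: {i}(_`_i); apply: reps_ind => k _; last first.
- exact/antisym_rot/rotation_odN.
- exact/antisym_rot/rotation_od.
by split; apply/antisym_rot; [exact: rotation_ev|exact: rotation_evz].
Qed.

(** The second coordinate [f + g y = 0] forces f = g = 0; the first is then [s y = x r], and both
    sides vanish by uniqueness of components. *)
Lemma comb_eq0 s f g r : s \in <<reps>>%VS -> f \in <<reps>>%VS ->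
  g \in <<reps>>%VS -> r \in <<reps>>%VS ->
  ds s + df f + dg g = dr r -> [/\ s = 0, f = 0, g = 0 & r = 0].
Proof.
move=> /reps_rot rs /reps_rot rf /reps_rot rg /reps_rot rr [e1 e2].
rewrite add0r in e2; have [f0 g0] := rot_uniq rf rg e2.
move: e1; rewrite f0 g0 mulr0 mul0r !addr0 => /eqP.
rewrite -subr_eq0 -opprB oppr_eq0 => /eqP e1.
have [|||xr0 s0] := @rot_uniq _ _ _ _ _ n_gt0 V8n (x * r) (- s).
- exact/rotM/rr/rot_x.
- exact: rotN.
- by rewrite mulNr.
split=> //; first by rewrite -[s]opprK s0 oppr0.
by rewrite -[r](mulKr (group_elt_unit F a)) xr0 mulr0.
Qed.

Lemma dgN w : dg (- w) = - dg w.
Proof. by rewrite /g_value mulNr; congr (_, _); rewrite oppr0. Qed.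

(** The reference family for n nonzero in F, where r = 0; [coords2] adds the r-part for n zero in F.
    The listed pairs are compared with these. *)
Definition coords1 := map ds reps ++ map df reps ++ map dg reps.
Definition coords2 := coords1 ++ map dr reps.

Lemma coords2_free : free coords2.
Proof.
have E0 : 0 \in <<reps>>%VS by exact: mem0v.
have E_free : free reps by exact: antisym_free.
have ds0 : ds 0 = 0 by rewrite /s_value mul0r.
have df0 : df 0 = 0 by rewrite /f_value mulr0 mul0r.
have dg0 : dg 0 = 0 by rewrite /g_value mul0r.
have dr0 : dr 0 = 0 by rewrite /r_value mulr0.
apply: free_cat_disjoint.
- apply: free_cat_disjoint.
  + apply: free_map_lin ds_lin _ E_free => s Es s0.
    by have [] := comb_eq0 Es E0 E0 E0; rewrite ?df0 ?dg0 ?dr0 ?addr0.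
  + apply: free_cat_disjoint.
    * apply: free_map_lin df_lin _ E_free => f Ef f0.
      by have [] := comb_eq0 E0 Ef E0 E0; rewrite ?ds0 ?dg0 ?dr0 ?addr0 ?add0r.
    * apply: free_map_lin dg_lin _ E_free => g Eg g0.
      by have [] := comb_eq0 E0 E0 Eg E0; rewrite ?ds0 ?df0 ?dr0 ?addr0 ?add0r.
    move=> w /(span_map_lin _ _ df_lin)[f Ef ->] /(span_map_lin _ _ dg_lin)[g Eg e].
    have Eg' : - g \in <<reps>>%VS by rewrite memvN.
    have [|_ -> _ _] := comb_eq0 E0 Ef Eg' E0; last by rewrite df0.
    by rewrite ds0 dr0 add0r e dgN subrr.
  move=> w /(span_map_lin _ _ ds_lin)[s Es ->]; rewrite span_cat.
  case/memv_addP=> _ /(span_map_lin _ _ df_lin)[f Ef ->].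
  case=> _ /(span_map_lin _ _ dg_lin)[g Eg ->] e.
  have Ef' : - f \in <<reps>>%VS by rewrite memvN.
  have Eg' : - g \in <<reps>>%VS by rewrite memvN.
  have [|-> _ _ _] := comb_eq0 Es Ef' Eg' E0; last by rewrite ds0.
  by rewrite e dfN dgN dr0 -addrA -opprD subrr.
- by apply: free_map_lin dr_lin _ E_free => r Er r0;
    have [] := comb_eq0 E0 E0 E0 Er; rewrite ?ds0 ?df0 ?dg0 ?dr0 ?addr0.
move=> w; rewrite !span_cat => /memv_addP[_ /(span_map_lin _ _ ds_lin)[s Es ->] [t]].
case/memv_addP=> _ /(span_map_lin _ _ df_lin)[f Ef ->] [u].
case/(span_map_lin _ _ dg_lin)=> g Eg -> -> ->.
case/(span_map_lin _ _ dr_lin)=> r Er e.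
have [|-> -> -> _] := comb_eq0 Es Ef Eg Er; first by rewrite -addrA.
by rewrite ds0 df0 dg0 !addr0.
Qed.

Lemma coords1_free : free coords1.
Proof. by have := coords2_free; rewrite /coords2 cat_free => /and3P[]. Qed.

Lemma basis1_Dv w : w \in basis1 -> Dv w.
Proof.
have Pds v : Dv (ds v) -> Dv (- ds v) by apply: Der_valueN.
rewrite mem_cat => /orP[|].
  move: w; apply: family_ind => k _ w; rewrite !inE.
  case/or4P=> [/eqP->|/eqP->|/eqP->|/or3P[]/eqP->].
  - exact/Pds/(Dv_ds two_neq0 (rotation_ev k)).
  - exact: (Dv_df two_neq0 (rotation_ev k)).
  - exact/Pds/(Dv_ds two_neq0 (rotation_evz k)).
  - exact: (Dv_df two_neq0 (rotation_evz k)).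
  - exact: (Dv_dg F (rotation_ev k)).
  - exact: (Dv_dg F (rotation_evz k)).
rewrite mem_cat => /orP[|].
  move: w; apply: family_ind => k _ w; rewrite !inE => /orP[]/eqP->.
  - exact: (Dv_df two_neq0 (rotation_od k)).
  - exact: (Dv_dg F (rotation_od k)).
rewrite mem_cat => /orP[|].
  move: w; apply: family_ind => k _ w; rewrite !inE => /orP[]/eqP->.
  - exact: (Dv_df two_neq0 (rotation_odN k)).
  - exact: (Dv_dg F (rotation_odN k)).
move: w; apply: family_ind => k _ w; rewrite !inE => /eqP->.
exact: (Dv_ds two_neq0 (rotation_odN k)).
Qed.

Lemma basis2_Dv w : n%:R = 0 :> F -> w \in basis2 -> Dv w.
Proof.
move=> n0; rewrite mem_cat => /orP[|].
  move: w; apply: family_ind => k _ w; rewrite !inE.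
  have Dr := Dv_dr n0 (rotation_ev k); have Drz := Dv_dr n0 (rotation_evz k).
  case/or4P=> [/eqP->|/eqP->|/eqP->|/or4P[/eqP->|/eqP->|/eqP->|/orP[]/eqP->]].
  - exact: (Dv_df two_neq0 (rotation_ev k)).
  - exact: Der_valueD Dr (Dv_dg F (rotation_ev k)).
  - exact: (Dv_df two_neq0 (rotation_evz k)).
  - exact: Der_valueD Drz (Dv_dg F (rotation_evz k)).
  - exact/Der_valueN/(Dv_ds two_neq0 (rotation_evz k)).
  - exact/Der_valueN/(Dv_ds two_neq0 (rotation_ev k)).
  - exact/Der_valueN.
  - exact/Der_valueN.
rewrite mem_cat => /orP[|].
  move: w; apply: family_ind => k _ w; rewrite !inE => /orP[]/eqP->.
  - exact: (Dv_df two_neq0 (rotation_od k)).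
  - exact: Der_valueD (Dv_dr n0 (rotation_od k)) (Dv_dg F (rotation_od k)).
rewrite mem_cat => /orP[|].
  move: w; apply: family_ind => k _ w; rewrite !inE => /orP[]/eqP->.
  - exact: (Dv_df two_neq0 (rotation_odN k)).
  - exact: Der_valueD (Dv_dr n0 (rotation_odN k)) (Dv_dg F (rotation_odN k)).
move: w; apply: family_ind => k _ w; rewrite !inE => /orP[]/eqP->.
- exact: (Dv_ds two_neq0 (rotation_odN k)).
- exact: (Dv_dr n0 (rotation_odN k)).
Qed.

Lemma size_coords1 : size coords1 = (if odd n then 3 * (2 * n - 1) else 6 * (n - 1))%N.
Proof.
rewrite /coords1 !size_cat !size_map size_orbit_reps //.
by clear two_neq0; case: ifP => [|/negbT] n_odd; lia.
Qed.

Lemma size_coords2 : size coords2 = (if odd n then 4 * (2 * n - 1) else 8 * (n - 1))%N.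
Proof.
rewrite /coords2 /coords1 !size_cat !size_map size_orbit_reps //.
by clear two_neq0; case: ifP => [|/negbT] n_odd; lia.
Qed.

Lemma size_basis1 : size basis1 = size coords1.
Proof.
rewrite size_coords1 /basis1 /even_values1 /odd_values1 !size_cat.
rewrite (size_family _ (c := 6)) // (size_family _ (c := 2)) //
  (size_family _ (c := 2)) // (size_family _ (c := 1)) //.
by clear two_neq0; case: ifP => [|/negbT] n_odd; lia.
Qed.

Lemma size_basis2 : size basis2 = size coords2.
Proof.
rewrite size_coords2 /basis2 !size_cat.
rewrite (size_family _ (c := 8)) // (size_family _ (c := 2)) //
  (size_family _ (c := 2)) // (size_family _ (c := 2)) //.
by clear two_neq0; case: ifP => [|/negbT] n_odd; lia.
Qed.

Lemma memv_spanN (V : vectType F) (X : seq V) v : - v \in X -> v \in <<X>>%VS.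
Proof. by move=> Xv; rewrite -memvN memv_span. Qed.

Local Opaque s_value f_value g_value r_value antisym.
Local Opaque even_rep z_even_rep odd_rep oddN_rep.

Lemma coords1_sub : {subset coords1 <= <<basis1>>%VS}.
Proof.
have B1 k w : (0 < k <= (n - 1) %/ 2)%N -> w \in even_values1 (ev k) (evz k) ->
    w \in basis1.
  move=> k_n kw; rewrite mem_cat.
  by rewrite (mem_family (E := fun k => even_values1 (ev k) (evz k)) k_n kw).
have B2 k w : (0 < k <= (n + 1) %/ 2)%N -> w \in odd_values1 (od k) -> w \in basis1.
  move=> k_n kw; rewrite mem_cat [X in _ || X]mem_cat.
  by rewrite (mem_family (E := fun k => odd_values1 (od k)) k_n kw) orbT.
have B3 k w : (0 < k <= n %/ 2)%N -> w \in odd_values1 (odN k) -> w \in basis1.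
  move=> k_n kw; rewrite mem_cat [X in _ || X]mem_cat [X in _ || (_ || X)]mem_cat.
  by rewrite (mem_family (E := fun k => odd_values1 (odN k)) k_n kw) !orbT.
have B4 k : (0 < k <= n)%N -> ds (odN k) \in basis1.
  move=> k_n; rewrite mem_cat [X in _ || X]mem_cat [X in _ || (_ || X)]mem_cat.
  by rewrite (mem_family (E := fun k => [:: ds (odN k)]) k_n (mem_head _ _)) !orbT.
move=> w; rewrite mem_cat => /orP[/mapP[v Ev ->]|].
  move: v Ev; apply: reps_ind => k k_n.
  - by split; apply: memv_spanN; apply: (B1 k _ k_n); rewrite !inE eqxx ?orbT.
  - by rewrite od_odN; [apply/memv_span/B4|]; lia.
  - by apply/memv_span/B4; lia.
rewrite mem_cat => /orP[] /mapP[v Ev ->].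
  move: v Ev; apply: reps_ind => k k_n.
  - by split; apply: memv_span; apply: (B1 k _ k_n); rewrite !inE eqxx ?orbT.
  - by apply: memv_span; apply: (B2 k _ k_n); rewrite !inE eqxx ?orbT.
  - by apply: memv_span; apply: (B3 k _ k_n); rewrite !inE eqxx ?orbT.
move: v Ev; apply: reps_ind => k k_n.
- by split; apply: memv_span; apply: (B1 k _ k_n); rewrite !inE eqxx ?orbT.
- by apply: memv_span; apply: (B2 k _ k_n); rewrite !inE eqxx ?orbT.
- by apply: memv_span; apply: (B3 k _ k_n); rewrite !inE eqxx ?orbT.
Qed.

(** The list contains g-values only summed with r-values, so the r-values are shown to lie in the
    span first and then subtracted. *)
Lemma coords2_sub : {subset coords2 <= <<basis2>>%VS}.
Proof.
have B1 k w : (0 < k <= (n - 1) %/ 2)%N -> w \in even_values2 (ev k) (evz k) ->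
    w \in basis2.
  move=> k_n kw; rewrite mem_cat.
  by rewrite (mem_family (E := fun k => even_values2 (ev k) (evz k)) k_n kw).
have B2 k w : (0 < k <= (n + 1) %/ 2)%N -> w \in odd_values2 (od k) -> w \in basis2.
  move=> k_n kw; rewrite mem_cat [X in _ || X]mem_cat.
  by rewrite (mem_family (E := fun k => odd_values2 (od k)) k_n kw) orbT.
have B3 k w : (0 < k <= n %/ 2)%N -> w \in odd_values2 (odN k) -> w \in basis2.
  move=> k_n kw; rewrite mem_cat [X in _ || X]mem_cat [X in _ || (_ || X)]mem_cat.
  by rewrite (mem_family (E := fun k => odd_values2 (odN k)) k_n kw) !orbT.
have B4 k w : (0 < k <= n)%N -> w \in [:: ds (odN k); dr (odN k)] -> w \in basis2.
  move=> k_n kw; rewrite mem_cat [X in _ || X]mem_cat [X in _ || (_ || X)]mem_cat.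
  by rewrite (mem_family (E := fun k => [:: ds (odN k); dr (odN k)]) k_n kw) !orbT.
have B4s k : (0 < k <= n)%N -> ds (odN k) \in basis2.
  by move=> k_n; apply: (B4 k _ k_n); rewrite mem_head.
have B4r k : (0 < k <= n)%N -> dr (odN k) \in basis2.
  by move=> k_n; apply: (B4 k _ k_n); rewrite inE mem_head orbT.
have dr_sub v : v \in reps -> dr v \in <<basis2>>%VS.
  move: v; apply: reps_ind => k k_n.
  - by split; apply: memv_spanN; apply: (B1 k _ k_n); rewrite !inE eqxx ?orbT.
  (* The r-values of odd representatives occur alone only in the fourth family, hence the change of
     index. *)
  - by rewrite od_odN; [apply/memv_span/B4r|]; lia.
  - by apply/memv_span/B4r; lia.
have sub_dr v : v \in reps -> dr v + dg v \in <<basis2>>%VS -> dg v \in <<basis2>>%VS.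
  by move=> /dr_sub drv drg; rewrite -[dg v](addKr (dr v)) memvD // memvN.
move=> w; rewrite mem_cat => /orP[|/mapP[v Ev ->]]; last exact: dr_sub.
rewrite mem_cat => /orP[/mapP[v Ev ->]|].
  move: v Ev; apply: reps_ind => k k_n.
  - by split; apply: memv_spanN; apply: (B1 k _ k_n); rewrite !inE eqxx ?orbT.
  - by rewrite od_odN; [apply/memv_span/B4s|]; lia.
  - by apply/memv_span/B4s; lia.
rewrite mem_cat => /orP[] /mapP[v Ev ->].
  move: v Ev; apply: reps_ind => k k_n.
  - by split; apply: memv_span; apply: (B1 k _ k_n); rewrite !inE eqxx ?orbT.
  - by apply: memv_span; apply: (B2 k _ k_n); rewrite !inE eqxx ?orbT.
  - by apply: memv_span; apply: (B3 k _ k_n); rewrite !inE eqxx ?orbT.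
apply: sub_dr (Ev) _; move: v Ev; apply: reps_ind => k k_n.
- by split; apply: memv_span; apply: (B1 k _ k_n); rewrite !inE eqxx ?orbT.
- by apply: memv_span; apply: (B2 k _ k_n); rewrite !inE eqxx ?orbT.
- by apply: memv_span; apply: (B3 k _ k_n); rewrite !inE eqxx ?orbT.
Qed.

Lemma Der_span2 (d : 'End(FG)) : d \in Der FG -> (d x, d y) \in <<coords2>>%VS.
Proof.
move=> /(Der_shape n_gt0 V8n two_neq0)[r [s [f [g [[ar as_ af ag] -> -> _]]]]].
have -> : (x * r + (x^-1 * f + s) * y, f + g * y) = ds s + (df f + dg g) + dr r.
  congr (_, _) => /=; last by rewrite add0r addr0.
  by rewrite addr0 mulrDl addrC; congr (_ + _); apply: addrC.
rewrite !span_cat; apply: memv_add; last first.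
  by apply/(span_map_lin _ _ dr_lin); exists r => //; apply: antirot_span ar.
apply: memv_add.
  by apply/(span_map_lin _ _ ds_lin); exists s => //; apply: antirot_span as_.
apply: memv_add.
  by apply/(span_map_lin _ _ df_lin); exists f => //; apply: antirot_span af.
by apply/(span_map_lin _ _ dg_lin); exists g => //; apply: antirot_span ag.
Qed.

Lemma Der_span1 (d : 'End(FG)) : n%:R != 0 :> F ->
  d \in Der FG -> (d x, d y) \in <<coords1>>%VS.
Proof.
move=> n_neq0 /(Der_shape n_gt0 V8n two_neq0)[r [s [f [g [[ar as_ af ag] -> ->]]]]].
move=> /(_ n_neq0) ->.
have -> : (x * 0 + (x^-1 * f + s) * y, f + g * y) = ds s + (df f + dg g).
  congr (_, _) => /=; last by rewrite add0r.
  by rewrite mulr0 addr0 add0r mulrDl addrC.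
rewrite !span_cat; apply: memv_add.
  by apply/(span_map_lin _ _ ds_lin); exists s => //; apply: antirot_span as_.
apply: memv_add.
  by apply/(span_map_lin _ _ df_lin); exists f => //; apply: antirot_span af.
by apply/(span_map_lin _ _ dg_lin); exists g => //; apply: antirot_span ag.
Qed.

Lemma Der_inj (d : 'End(FG)) : d \in Der FG -> d x = 0 -> d y = 0 -> d = 0.
Proof.
move=> D dx dy; apply/lfunP=> v; rewrite zero_lfunE [v]sum_group_elt linear_sum /=.
apply: big1 => g _; rewrite linearZ /= (Der_eq0 (A := [set a; b]) D) ?scaler0 //.
  by move=> h; rewrite !inE => /orP[]/eqP->.
by case: V8n => _ -> _ _ _; rewrite inE.
Qed.

End Assembly.

(** * Dimension and basis, according to whether n vanishes in F *)

Theorem theorem3p1 (n : nat) (F : fieldType) (p : nat)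
    (gT : finGroupType) (a b : gT)
    (n_gt0 : (0 < n)%N) (p_prime : prime p) (p_odd : odd p)
    (V8n : is_V8n n a b) :
  let Der_FV := Der (group_algebra F gT) in
  let x : group_algebra F gT := group_elt F a in
  let y : group_algebra F gT := group_elt F b in
  ([pchar F] =i pred0 \/ (p \in [pchar F] /\ gcdn n p = 1%N) ->
     \dim Der_FV = (if odd n then 3 * (2 * n - 1) else 6 * (n - 1))%N
     /\ Der_basis_on x y (B1 n x y ++ B2 n x y ++ B3 n x y ++ B4 n x y))
  /\
  (p \in [pchar F] /\ gcdn n p <> 1%N ->
     \dim Der_FV = (if odd n then 4 * (2 * n - 1) else 8 * (n - 1))%N
     /\ Der_basis_on x y (B1' n x y ++ B2' n x y ++ B3' n x y ++ B4' n x y)).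
Proof.
move=> Der_FV x y.
have p2 : ~~ (p %| 2)%N.
  rewrite (dvdn_prime2 p_prime) //; by apply: contraTneq p_odd => ->.
have basis := Der_basis_onP (Der_inj (F := F) V8n); split=> [charF|[charF pn]].
  (* In characteristic p, coprimality with n means that p does not divide n; in characteristic 0
     both integers are nonzero in F. *)
  have [two_neq0 n_neq0] : 2%:R != 0 :> F /\ n%:R != 0 :> F.
    case: charF => [/pcharf0P char0|[charF pn]].
      by split; rewrite char0 -?lt0n.
    rewrite -!(dvdn_pcharf charF) p2; split=> //.
    by rewrite -prime_coprime // coprime_sym /coprime pn.
  rewrite (basis1E F n_gt0 V8n) -(size_coords1 F a b n_gt0).
  apply: basis.
  - exact: basis1_Dv.
  - by move=> d; apply: Der_span1.
  - exact: coords1_free.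
  - exact: coords1_sub.
  - exact: size_basis1.
have two_neq0 : 2%:R != 0 :> F by rewrite -(dvdn_pcharf charF).
(* As p is prime, a gcd different from 1 means that p divides n. *)
have n0 : n%:R = 0 :> F.
  apply/eqP; rewrite -(dvdn_pcharf charF); apply: contra_notT pn.
  by rewrite -prime_coprime // coprime_sym => /eqP.
rewrite (basis2E F n_gt0 V8n) -(size_coords2 F a b n_gt0).
apply: basis.
- by move=> w; apply: basis2_Dv.
- exact: Der_span2.
- exact: coords2_free.
- exact: coords2_sub.
- exact: size_basis2.
Qed.
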